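(* Let $X_1,\dots,X_n$ be i.i.d. real random variables with zero mean, unit variance and finite fourth moment. Let $A=(a_{ij})_{i,j=1}^n$ be a real symmetric matrix with $a_{ii}=0$ for all $1\le i\le n$. Put $$\sigma_n^2=2\sum_{i=1}^n\sum_{j=1}^n a_{ij}^2>0,\qquad W_n=\frac{1}{\sigma_n}\sum_{i\ne j}a_{ij}X_iX_j .$$ Then there is a constant $C$ depending only on $EX_1^4$ such that for every $z\in\mathbb{R}$, $$\big|P(W_n\le z)-\Phi(z)\big|\le\frac{C\,EX_1^4}{(1+|z|)^2\sigma_n^2}\left(\sqrt{\sum_{i}\Big(\sum_{j}a_{ij}^2\Big)^2}+\sqrt{\sum_{i,j}\Big(\sum_{k}a_{ik}a_{jk}\Big)^2}\right).$$
   Context: $\Phi$ is the standard normal distribution function. All sums run over indices in $\{1,\dots,n\}$; $\sigma_n$ is the positive square root of $\sigma_n^2$. *)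

(* Defs.v *)
From mathcomp Require Import all_boot all_order all_algebra.
From mathcomp Require Import all_classical all_reals all_analysis.

Set Implicit Arguments.
Unset Strict Implicit.
Unset Printing Implicit Defensive.

Import Order.TTheory GRing.Theory Num.Theory.
Import numFieldNormedType.Exports.

Local Open Scope classical_set_scope.
Local Open Scope ring_scope.

Definition mutually_independent (d : measure_display) (T : measurableType d)
    (R : realType) (P : probability T R) (n : nat)
    (X : 'I_n -> {RV P >-> R}) : Prop :=
  forall (J : {set 'I_n}) (B : 'I_n -> set R),
    (forall i, measurable (B i)) ->
    P (\bigcap_(i in [set i | i \in J]) (X i @^-1` B i)) =
    (\prod_(i in J) P (X i @^-1` B i))%E.

Definition identically_distributed (d : measure_display)
    (T : measurableType d) (R : realType) (P : probability T R) (n : nat)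
    (X : 'I_n -> {RV P >-> R}) : Prop :=
  forall (i j : 'I_n) (B : set R), measurable B ->
    distribution P (X i) B = distribution P (X j) B.

Definition iid (d : measure_display) (T : measurableType d) (R : realType)
    (P : probability T R) (n : nat) (X : 'I_n -> {RV P >-> R}) : Prop :=
  mutually_independent X /\ identically_distributed X.

Definition Phi (R : realType) (z : R) : R :=
  fine (normal_prob (0 : R) 1 `]-oo, z]).

Definition sigma2 (R : realType) (n : nat) (A : 'M[R]_n) : R :=
  2 * \sum_i \sum_j A i j ^+ 2.

Definition W (T : Type) (R : realType) (n : nat) (A : 'M[R]_n)
    (X : 'I_n -> T -> R) (t : T) : R :=
  (Num.sqrt (sigma2 A))^-1 * \sum_i \sum_(j | i != j) A i j * X i t * X j t.

(* Main.v *)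
Require Import Defs.
From HB Require Import structures.
From mathcomp Require Import all_boot all_order all_algebra.
From mathcomp Require Import all_classical all_reals all_analysis.
From mathcomp Require Import measurable_realfun ring lra.

Import Order.TTheory GRing.Theory Num.Theory.
Import numFieldNormedType.Exports HBNNSimple.

Set Implicit Arguments.
Unset Strict Implicit.
Unset Printing Implicit Defensive.

Local Open Scope classical_set_scope.
Local Open Scope ring_scope.


(** Put b = A / sigma, so that W = sum_(i <> j) b_ij X_i X_j and
    2 sum_(i,j) b_ij^2 = 1. The proof is Stein's method for an exchangeable
    pair. Replacing X_i by an independent copy X'_i changes W by
    D_i = 2 (X_i - X'_i) Y_i, where Y_i = sum_j b_ij X_j does not involve X_i,
    and sum_i E (D_i | X) = 2 W. By the antisymmetry of the pair,
    E W f(W) = 1/4 sum_i E D_i (f(W) - f(W - D_i)). Take for f the bounded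
    solution of f'(w) - w f(w) = 1(w <= z) - Phi(z). Since w f(w) is
    nondecreasing and 1(w <= z) is nonincreasing, f(W) - f(W - D_i) differs from
    D_i f'(W) by at most |D_i| times an increment of monotone functions of W.
    Multiplied by D_i and averaged, such an increment becomes, by antisymmetry
    again, a mean against E (|D_i| D_i | X). This gives
      |P (W <= z) - Phi(z)| <= E |f'(W)| |1 - K| + E |W f(W)| |G|
                               + |E 1(W <= z) G|
    with K = 1/4 sum_i E (D_i^2 | X) and G = 1/2 sum_i E (|D_i| D_i | X)
    ([exchangeable_pair_bound]): two quantities of mean 1 and 0 whose variances
    only involve fourth moments.

    Both variances are O(m4^2 (sum_i (sum_j b_ij^2)^2 + tr b^4)). Up to a
    quadratic form with matrix b b^T, both variables are sums
    sum_i psi(X_i) s(Y_i) with psi centred and s of quadratic growth. In the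
    second moment of such a sum the term (i, j) with i <> j would vanish if Y_i
    did not involve X_j and Y_j did not involve X_i; as they do so through
    b_ij only, the term is O(b_ij^2) ([mean_weighted_sum_sqr_le]).

    For the factor (1 + |z|)^-2: f' and w f(w) are bounded by 1, and by
    10 (1 + |z|)^-2 if |w| <= |z| / 2. On the event |W| > |z| / 2 the
    Cauchy-Schwarz inequality leaves the square root of its probability, which
    is O((1 + |z|)^-2) as soon as E W^4 is bounded; and E W^4 <= 9 E K^2, by
    Stein's identity for f(w) = w^3 ([mean_fourth_le]).

    All of this is done for variables with finitely many values, where
    expectations are finite sums over a product space, independent copies are
    one more summation index, and conditioning is a partial sum. In general, X_i
    is the pointwise limit of standardised finite-valued functions of X_i
    ([id_approximation]), whose fourth moments stay below a multiple of m4; the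
    bound passes to the limit because Phi is continuous
    ([Phi_bound_of_approx]). *)

(** * Expectations over finite product spaces *)

Section FiniteProduct.
Variables (R : realFieldType) (I J : finType) (p : I -> R).
Implicit Types (w : {ffun J -> I}) (F G : {ffun J -> I} -> R) (h : I -> R).

Definition mean1 h := \sum_a p a * h a.
Definition mass w := \prod_i p (w i).
Definition mean F := \sum_w mass w * F w.

(** Averaging over [a] with weights [p] after [upd w i a] amounts to replacing
    the [i]-th variable by an independent copy. *)
Definition upd w i a : {ffun J -> I} := [ffun j => if j == i then a else w j].
Definition free_of i F := forall w a, F (upd w i a) = F w.

Hypothesis p_ge0 : forall a, 0 <= p a.
Hypothesis p_sum1 : \sum_a p a = 1.

Lemma upd_same w i a : upd w i a i = a.
Proof. by rewrite ffunE eqxx. Qed.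

Lemma upd_other w i a j : j != i -> upd w i a j = w j.
Proof. by rewrite ffunE => /negbTE ->. Qed.

Lemma updK w i a : upd (upd w i a) i (w i) = w.
Proof. by apply/ffunP => j; rewrite !ffunE; case: eqP => // ->. Qed.

Lemma mass_ge0 w : 0 <= mass w.
Proof. exact: prodr_ge0. Qed.

Lemma mean1D h k : mean1 (fun a => h a + k a) = mean1 h + mean1 k.
Proof. by rewrite /mean1 -big_split; apply: eq_bigr => a _; rewrite mulrDr. Qed.

Lemma mean1Z c h : mean1 (fun a => c * h a) = c * mean1 h.
Proof. by rewrite /mean1 mulr_sumr; apply: eq_bigr => a _; rewrite mulrCA. Qed.

Lemma mean1N h : mean1 (fun a => - h a) = - mean1 h.
Proof. by rewrite /mean1 -sumrN; apply: eq_bigr => a _; rewrite mulrN. Qed.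

Lemma mean1B h k : mean1 (fun a => h a - k a) = mean1 h - mean1 k.
Proof. by rewrite mean1D mean1N. Qed.

Lemma mean1_cst c : mean1 (fun=> c) = c.
Proof. by rewrite /mean1 -mulr_suml p_sum1 mul1r. Qed.

Lemma eq_mean1 h k : h =1 k -> mean1 h = mean1 k.
Proof. by move=> e; apply: eq_bigr => a _; rewrite e. Qed.

Lemma le_mean1 h k : (forall a, h a <= k a) -> mean1 h <= mean1 k.
Proof. by move=> le; apply: ler_sum => a _; apply: ler_wpM2l. Qed.

Lemma mean1_ge0 h : (forall a, 0 <= h a) -> 0 <= mean1 h.
Proof. by move=> le; apply: sumr_ge0 => a _; apply: mulr_ge0. Qed.

Lemma normr_mean1_le h : `|mean1 h| <= mean1 (fun a => `|h a|).
Proof.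
apply: le_trans (ler_norm_sum _ _ _) _; apply: ler_sum => a _.
by rewrite normrM ger0_norm.
Qed.

Lemma meanD F G : mean (fun w => F w + G w) = mean F + mean G.
Proof. by rewrite /mean -big_split; apply: eq_bigr => w _; rewrite mulrDr. Qed.

Lemma meanZ c F : mean (fun w => c * F w) = c * mean F.
Proof. by rewrite /mean mulr_sumr; apply: eq_bigr => w _; rewrite mulrCA. Qed.

Lemma meanN F : mean (fun w => - F w) = - mean F.
Proof. by rewrite /mean -sumrN; apply: eq_bigr => w _; rewrite mulrN. Qed.

Lemma meanB F G : mean (fun w => F w - G w) = mean F - mean G.
Proof. by rewrite meanD meanN. Qed.

Lemma mean_sum (K : Type) (s : seq K) (P : pred K)
    (F : K -> {ffun J -> I} -> R) :
  mean (fun w => \sum_(k <- s | P k) F k w) = \sum_(k <- s | P k) mean (F k).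
Proof.
rewrite /mean exchange_big; apply: eq_bigr => w _.
by rewrite mulr_sumr.
Qed.

Lemma mean_cst c : mean (fun=> c) = c.
Proof.
rewrite /mean -mulr_suml -(bigA_distr_bigA (fun _ a => p a)).
by rewrite big1 ?mul1r.
Qed.

Lemma eq_mean F G : F =1 G -> mean F = mean G.
Proof. by move=> e; apply: eq_bigr => w _; rewrite e. Qed.

Lemma le_mean F G : (forall w, F w <= G w) -> mean F <= mean G.
Proof. by move=> le; apply: ler_sum => w _; rewrite ler_wpM2l ?mass_ge0. Qed.

Lemma mean_ge0 F : (forall w, 0 <= F w) -> 0 <= mean F.
Proof. by move=> le; apply: sumr_ge0 => w _; rewrite mulr_ge0 ?mass_ge0. Qed.

Lemma normr_mean_le F : `|mean F| <= mean (fun w => `|F w|).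
Proof.
apply: le_trans (ler_norm_sum _ _ _) _; apply: ler_sum => w _.
by rewrite normrM ger0_norm ?mass_ge0.
Qed.

(** Prescribed upper bounds [a] and [b] instead of square roots: the inequality
    2 x y <= (b / a) x^2 + (a / b) y^2 then gives the result at once. *)
Lemma mean_CauchySchwarz F G (a b : R) : 0 < a -> 0 < b ->
  mean (fun w => F w ^+ 2) <= a ^+ 2 -> mean (fun w => G w ^+ 2) <= b ^+ 2 ->
  mean (fun w => `|F w| * `|G w|) <= a * b.
Proof.
move=> a0 b0 FA GB.
have amgm w : `|F w| * `|G w| <=
    (b / a / 2) * F w ^+ 2 + (a / b / 2) * G w ^+ 2.
  rewrite -(real_normK (num_real (F w))) -(real_normK (num_real (G w))).
  set x := `|F w|; set y := `|G w|; rewrite -subr_ge0.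
  have -> : b / a / 2 * x ^+ 2 + a / b / 2 * y ^+ 2 - x * y =
     (b * x - a * y) ^+ 2 / (2 * a * b).
    by field; rewrite !gt_eqF.
  by rewrite divr_ge0 ?sqr_ge0// !mulr_ge0// ltW.
apply: le_trans (le_mean amgm) _; rewrite meanD !meanZ.
have -> : a * b = b / a / 2 * a ^+ 2 + a / b / 2 * b ^+ 2.
  by field; rewrite !gt_eqF.
by rewrite lerD// ler_wpM2l// !divr_ge0// ltW.
Qed.

(** Exchangeability: (w, a) |-> (upd w i a, w i) is an involution that preserves
    the weight mass w * p a. *)
Lemma mean_swap i (G : {ffun J -> I} -> I -> R) :
  mean (fun w => mean1 (G w)) =
  mean (fun w => mean1 (fun a => G (upd w i a) (w i))).
Proof.
rewrite /mean /mean1; under eq_bigr do rewrite mulr_sumr.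
under [RHS]eq_bigr do rewrite mulr_sumr.
rewrite !pair_bigA /=.
pose s (u : {ffun J -> I} * I) := (upd u.1 i u.2, u.1 i).
have sK : involutive s by move=> [w a]; rewrite /s /= updK upd_same.
rewrite (reindex_inj (inv_inj sK)) /=; apply: eq_bigr => [[w a] _] /=.
rewrite !mulrA; congr (_ * _).
rewrite /mass (bigD1 i)//= [in RHS](bigD1 i)//= upd_same.
rewrite mulrAC [RHS]mulrAC [p (w i) * _]mulrC; congr (_ * _).
by apply: eq_bigr => j ji; rewrite upd_other.
Qed.

Lemma mean_upd i F : mean F = mean (fun w => mean1 (fun a => F (upd w i a))).
Proof.
rewrite -(mean_swap i (fun w _ => F w)); apply: eq_mean => w.
by rewrite mean1_cst.
Qed.

Lemma mean_indep i h F : free_of i F ->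
  mean (fun w => h (w i) * F w) = mean1 h * mean F.
Proof.
move=> Fi; rewrite (mean_upd i) -meanZ; apply: eq_mean => w.
rewrite mulrC -mean1Z; apply: eq_mean1 => a.
by rewrite upd_same Fi mulrC.
Qed.

Lemma mean_coord i h : mean (fun w => h (w i)) = mean1 h.
Proof.
rewrite -[RHS]mulr1 -(mean_cst 1) -(mean_indep (i := i)) //.
by apply: eq_mean => w; rewrite mulr1.
Qed.

End FiniteProduct.

(** * Exchangeable pairs and Stein's identity *)

Section ExchangeablePair.
Variables (R : realFieldType) (I J : finType) (p : I -> R).
Hypothesis p_ge0 : forall a, 0 <= p a.
Hypothesis p_sum1 : \sum_a p a = 1.
Variable (F : {ffun J -> I} -> R).
Local Notation E := (mean p).
Local Notation E' := (mean1 p).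

Definition incr i w a := F w - F (upd w i a).
Definition sqvar w := \sum_i E' (fun a => incr i w a ^+ 2).

(** Oddness of D |-> |D| D makes the mean of [sgnvar] vanish; this statistic plays
    the part of a third absolute moment, but can benefit from cancellations. *)
Definition sgnvar w := \sum_i E' (fun a => `|incr i w a| * incr i w a).

(** The linearity condition E (F - F' | w) = lambda F on an exchangeable pair,
    with a sum over the coordinates instead of a uniformly chosen one. Multilinear
    forms of degree c in centred variables satisfy it. *)
Definition homogeneous (c : R) := forall w, \sum_i E' (incr i w) = c * F w.

(** The terms in g (F w) and in g (F (upd w i a)) are exchanged by [mean_swap] up
    to the sign of [o], so they contribute equally. *)
Lemma mean_incr_odd (o : R -> R) (g : R -> R) i :
  (forall x, o (- x) = - o x) ->
  E (fun w => E' (fun a => o (incr i w a) * (g (F w) - g (F (upd w i a))))) =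
  2 * E (fun w => g (F w) * E' (fun a => o (incr i w a))).
Proof.
move=> oN.
transitivity (E (fun w => g (F w) * E' (fun a => o (incr i w a))) -
  E (fun w => E' (fun a => o (incr i w a) * g (F (upd w i a))))).
  rewrite -meanB; apply: eq_mean => w; rewrite -mean1Z -mean1B.
  by apply: eq_mean1 => a; rewrite mulrBr [in RHS]mulrC.
rewrite [X in _ - X](mean_swap _ i) mulr_natl mulr2n; congr (_ + _).
rewrite -meanN; apply: eq_mean => w; rewrite -mean1Z -mean1N.
apply: eq_mean1 => a; rewrite /incr !updK.
by rewrite -opprB oN mulNr opprK mulrC.
Qed.

Lemma homogeneous_stein (c : R) (f : R -> R) : homogeneous c ->
  c * E (fun w => F w * f (F w)) =
  2^-1 * \sum_i E (fun w => E' (fun a =>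
     incr i w a * (f (F w) - f (F (upd w i a))))).
Proof.
move=> Fc; rewrite -meanZ.
under eq_bigr do rewrite (mean_incr_odd (o := id))//.
rewrite -mulr_sumr mulKf ?pnatr_eq0// -mean_sum; apply: eq_mean => w.
by rewrite -mulr_sumr mulrA -Fc mulrC.
Qed.

Lemma mean_sgnvar (g : R -> R) :
  \sum_i E (fun w => E' (fun a => `|incr i w a| * incr i w a *
     (g (F w) - g (F (upd w i a))))) = 2 * E (fun w => g (F w) * sgnvar w).
Proof.
under eq_bigr do
  rewrite (mean_incr_odd (o := fun x => `|x| * x)) => [|? /[!(normrN, mulrN)]//].
rewrite -mulr_sumr -mean_sum; congr (_ * _); apply: eq_mean => w.
by rewrite -mulr_sumr.
Qed.

Lemma mean_sgnvar0 : E sgnvar = 0.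
Proof.
have := mean_sgnvar (fun=> 1); under eq_bigr => i _.
  rewrite (_ : E _ = 0); last first.
    rewrite -(mean_cst J p_sum1 0); apply: eq_mean => w.
    by rewrite -[RHS](mean1_cst p_sum1); apply: eq_mean1 => a; rewrite subrr mulr0.
  over.
rewrite big1// => /esym/eqP; rewrite mulf_eq0 pnatr_eq0/= => /eqP <-.
by apply: eq_mean => w; rewrite mul1r.
Qed.

Lemma mean_sqvar (c : R) : homogeneous c -> E sqvar = 2 * c * E (fun w => F w ^+ 2).
Proof.
move=> Fc; rewrite -mulrA (homogeneous_stein id Fc) mulVKf ?pnatr_eq0//.
by rewrite -mean_sum.
Qed.

(** Stein's identity for the cube, with
    (x - y) (x^3 - y^3) <= 3/2 (x^2 + y^2) (x - y)^2, gives
    c E F^4 <= 3/2 E (F^2 sqvar); half of the left-hand side absorbs the F^4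
    that comes out of the right-hand side. *)
Lemma mean_fourth_le (c : R) : 0 < c -> homogeneous c ->
  E (fun w => F w ^+ 4) <= 9 * E (fun w => (sqvar w / (2 * c)) ^+ 2).
Proof.
move=> c0 Fc; set K := E (fun w => _ ^+ 2); set M := E _.
have := homogeneous_stein (fun u => u ^+ 3) Fc.
have -> : E (fun w => F w * F w ^+ 3) = M by apply: eq_mean => w; rewrite -exprS.
have le1 i : E (fun w => E' (fun a =>
     incr i w a * (F w ^+ 3 - F (upd w i a) ^+ 3))) <=
   3 * E (fun w => F w ^+ 2 * E' (fun a => incr i w a ^+ 2)).
  pose q w := F w ^+ 2 * E' (fun a => incr i w a ^+ 2).
  have Eq : E q = E (fun w => E' (fun a =>
      F (upd w i a) ^+ 2 * incr i w a ^+ 2)).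
    transitivity (E (fun w => E' (fun a => F w ^+ 2 * incr i w a ^+ 2))).
      by apply: eq_mean => w; rewrite mean1Z.
    rewrite (mean_swap _ i); apply: eq_mean => w; apply: eq_mean1 => a.
    by rewrite /incr updK -[in LHS]opprB sqrrN.
  have -> : 3 * E q = 3 / 2 * (E q + E q) by field.
  rewrite {2}Eq -meanD -meanZ; apply: le_mean => // w.
  rewrite /q -mean1Z -mean1D -mean1Z; apply: le_mean1 => // a.
  rewrite /incr; set x := F w; set y := F _; rewrite -subr_ge0.
  have -> : 3 / 2 * (x ^+ 2 * (x - y) ^+ 2 + y ^+ 2 * (x - y) ^+ 2) -
    (x - y) * (x ^+ 3 - y ^+ 3) = 2^-1 * ((x - y) * (x - y)) ^+ 2 by field.
  by rewrite mulr_ge0 ?invr_ge0 ?ler0n ?sqr_ge0.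
move=> Me; have : c * M <= 2^-1 * (3 * E (fun w => F w ^+ 2 * sqvar w)).
  rewrite Me ler_wpM2l ?invr_ge0 ?ler0n//; apply: le_trans (ler_sum _ (fun i _ => le1 i)) _.
  rewrite -mulr_sumr -mean_sum ler_wpM2l//; apply: le_mean => // w.
  by rewrite -mulr_sumr.
have : E (fun w => F w ^+ 2 * sqvar w) <= c / 3 * M + 3 * c * K.
  rewrite -!meanZ -meanD; apply: le_mean => // w; rewrite -subr_ge0.
  have -> : c / 3 * F w ^+ 4 + 3 * c * (sqvar w / (2 * c)) ^+ 2 -
    F w ^+ 2 * sqvar w = c / 3 * (F w ^+ 2 - 3 * (sqvar w / (2 * c))) ^+ 2.
    by field; rewrite gt_eqF.
  by rewrite mulr_ge0 ?sqr_ge0// divr_ge0// ltW.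
move=> h1 h2; rewrite -(ler_pM2l c0).
rewrite mulrA [c * 9]mulrC -mulrA; set cM := c * M in h1 h2 *.
have e : c / 3 * M = 3^-1 * cM by rewrite /cM; field.
rewrite e -mulrA in h1; set cK := c * K in h1 *; lra.
Qed.

Variables (f g : R -> R) (z t : R).
Hypothesis fg : forall u, g u = u * f u.
Hypothesis g_mono : {homo g : a b / a <= b}.
(* The function g + 1(. <= z) - t stands for the derivative of f. Over
   [a, b] it lies between the two bounds, because g is nondecreasing and the
   indicator is nonincreasing; in this form the jump at z needs no special
   treatment. *)
Hypothesis f_incr : forall a b : R, a <= b ->
  (b - a) * (g a + (b <= z)%R%:R - t) <= f b - f a <=
  (b - a) * (g b + (a <= z)%R%:R - t).

(** The first-order error is bounded by |x - y| times an increment of the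
    monotone function u |-> g u - 1(u <= z), whose sign is that of x - y. *)
Lemma stein_remainder_le (x y : R) :
  `|(x - y) * ((x - y) * (g x + (x <= z)%R%:R - t) - (f x - f y))| <=
  `|x - y| * (x - y) * ((g x - (x <= z)%R%:R) - (g y - (y <= z)%R%:R)).
Proof.
have mono (a b : R) : a <= b -> (b <= z)%R%:R <= (a <= z)%R%:R :> R.
  move=> ab; rewrite ler_nat; case: (leP b z) => // bz.
  by rewrite (le_trans ab bz).
case: (leP y x) => [yx|/ltW xy].
  have /andP[h1 h2] := f_incr yx; have h3 := mono _ _ yx; have h4 := g_mono yx.
  have d0 : 0 <= x - y by rewrite subr_ge0.
  rewrite normrM (ger0_norm d0) -mulrA ler_wpM2l// ler_norml.
  set d := x - y in d0 h1 h2 *.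
  have h5 := mulr_ge0 d0 (_ : 0 <= (y <= z)%R%:R - (x <= z)%R%:R).
  have h6 := mulr_ge0 d0 (_ : 0 <= g x - g y).
  rewrite !subr_ge0 in h5 h6; move: (h5 h3) (h6 h4) => {}h5 {}h6.
  by apply/andP; split; lra.
have /andP[h1 h2] := f_incr xy; have h3 := mono _ _ xy; have h4 := g_mono xy.
have d0 : 0 <= y - x by rewrite subr_ge0.
rewrite -(opprB y x) normrM !normrN (ger0_norm d0) -mulrA ler_wpM2l//.
rewrite ler_norml.
set d := y - x in d0 h1 h2 *.
have h5 := mulr_ge0 d0 (_ : 0 <= (x <= z)%R%:R - (y <= z)%R%:R).
have h6 := mulr_ge0 d0 (_ : 0 <= g y - g x).
rewrite !subr_ge0 in h5 h6; move: (h5 h3) (h6 h4) => {}h5 {}h6.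
by apply/andP; split; lra.
Qed.

(** The increments in [stein_remainder_le] are averaged by [mean_sgnvar], which
    turns them into means against [sgnvar]. *)
Lemma exchangeable_pair_bound (c : R) : 0 < c -> homogeneous c ->
  `|E (fun w => (F w <= z)%R%:R) - t| <=
  E (fun w => `|g (F w) + (F w <= z)%R%:R - t| * `|1 - sqvar w / (2 * c)|) +
  E (fun w => `|g (F w)| * `|sgnvar w / c|) +
  `|E (fun w => (F w <= z)%R%:R * (sgnvar w / c))|.
Proof.
move=> c0 Fc; set f' := fun u => g u + (u <= z)%R%:R - t.
pose err i w a := incr i w a * (incr i w a * f' (F w) -
   (f (F w) - f (F (upd w i a)))).
(* The error terms add up to the difference between the two sides of Stein's
   identity, in which f' is expanded at F w. *)
have key : E (fun w => (F w <= z)%R%:R) - t =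
    E (fun w => f' (F w) * (1 - sqvar w / (2 * c))) +
    (2 * c)^-1 * \sum_i E (fun w => E' (err i w)).
  have e1 : \sum_i E (fun w => E' (err i w)) =
      E (fun w => f' (F w) * sqvar w) - 2 * c * E (fun w => F w * f (F w)).
    rewrite -mulrA (homogeneous_stein f Fc) mulVKf ?pnatr_eq0//.
    transitivity (E (fun w => f' (F w) * sqvar w) - E (fun w => \sum_i
       E' (fun a => incr i w a * (f (F w) - f (F (upd w i a)))))).
      rewrite -mean_sum -meanB; apply: eq_mean => w.
      rewrite mulr_sumr -sumrB; apply: eq_bigr => i _.
      rewrite -mean1Z -mean1B; apply: eq_mean1 => a.
      by rewrite /err mulrBr mulrA -expr2 mulrC.
    by rewrite mean_sum.
  rewrite e1 mulrBr mulKf ?mulf_neq0 ?gt_eqF// -meanZ addrA -meanD -meanB.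
  rewrite -(mean_cst J p_sum1 t) -meanB; apply: eq_mean => w.
  by rewrite /f' fg; field; rewrite gt_eqF.
rewrite key; apply: le_trans (ler_normD _ _) _; rewrite -addrA lerD//.
  apply: le_trans (normr_mean_le p_ge0 _) _; apply: le_mean => // w.
  by rewrite normrM.
rewrite normrM ger0_norm; last by rewrite invr_ge0 mulr_ge0// ltW.
rewrite -ler_pdivlMl ?invr_gt0 ?mulr_gt0// invrK.
apply: (@le_trans _ _ (2 * E (fun w => (g (F w) - (F w <= z)%R%:R) * sgnvar w))).
  rewrite -(mean_sgnvar (fun u => g u - (u <= z)%R%:R)).
  apply: le_trans (ler_norm_sum _ _ _) _; apply: ler_sum => i _.
  apply: le_trans (normr_mean_le p_ge0 _) _; apply: le_mean => // w.
  apply: le_trans (normr_mean1_le p_ge0 _) _; apply: le_mean1 => // a.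
  exact: stein_remainder_le.
rewrite -mulrA ler_pM2l// -[leLHS](mulVKf (lt0r_neq0 c0)) ler_pM2l//.
rewrite -meanZ.
apply: (@le_trans _ _ (E (fun w => `|g (F w)| * `|sgnvar w / c| -
   (F w <= z)%R%:R * (sgnvar w / c)))).
  apply: le_mean => // w; rewrite -normrM mulrC mulrBl mulrBl !mulrA lerD2r.
  by rewrite ler_norm.
by rewrite meanB lerD2l -normrN ler_norm.
Qed.

End ExchangeablePair.

(** * Linear forms in independent variables *)

Lemma sum_CauchySchwarz (R : realFieldType) (J : finType) (a b : J -> R) :
  (\sum_i a i * b i) ^+ 2 <= (\sum_i a i ^+ 2) * (\sum_i b i ^+ 2).
Proof.
have : 0 <= \sum_i \sum_j (a i * b j - a j * b i) ^+ 2.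
  by apply: sumr_ge0 => i _; apply: sumr_ge0 => j _; rewrite sqr_ge0.
have -> : \sum_i \sum_j (a i * b j - a j * b i) ^+ 2 =
    2 * ((\sum_i a i ^+ 2) * (\sum_i b i ^+ 2) - (\sum_i a i * b i) ^+ 2).
  transitivity (\sum_i \sum_j (a i ^+ 2 * b j ^+ 2 +
      b i ^+ 2 * a j ^+ 2 + (- 2) * ((a i * b i) * (a j * b j)))).
    by apply: eq_bigr => i _; apply: eq_bigr => j _; ring.
  under eq_bigr do rewrite !big_split/= -!mulr_sumr.
  rewrite !big_split/= -!mulr_sumr -!mulr_suml; ring.
by rewrite pmulr_rge0// subr_ge0.
Qed.

Section LinearForms.
Variables (R : realFieldType) (I J : finType) (p : I -> R).
Hypothesis p_ge0 : forall a, 0 <= p a.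
Hypothesis p_sum1 : \sum_a p a = 1.
Local Notation E := (mean p).
Local Notation E' := (mean1 p).

Definition lin (u : I -> R) (c : J -> R) (w : {ffun J -> I}) :=
  \sum_j c j * u (w j).

Lemma incr_lin u c i w a : incr (lin u c) i w a = c i * (u (w i) - u a).
Proof.
rewrite /incr /lin -sumrB (bigD1 i)//= upd_same -mulrBr big1 ?addr0// => j ji.
by rewrite upd_other// subrr.
Qed.

Lemma lin_free u c i : c i = 0 -> free_of i (lin u c).
Proof.
move=> ci w a; apply/eqP; rewrite eq_sym -subr_eq0 -[_ - _]/(incr _ _ _ _).
by rewrite incr_lin ci mul0r.
Qed.

Variable u : I -> R.
Hypothesis Eu : E' u = 0.

Lemma mean1_sqrB x : E' (fun a => (x - u a) ^+ 2) = x ^+ 2 + E' (fun a => u a ^+ 2).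
Proof.
transitivity (E' (fun a => x ^+ 2 + ((- 2 * x) * u a + u a ^+ 2))).
  by apply: eq_mean1 => a; ring.
by rewrite !mean1D mean1_cst// mean1Z Eu mulr0 add0r.
Qed.

Lemma lin_homogeneous c : homogeneous p (lin u c) 1.
Proof.
move=> w; rewrite mul1r; apply: eq_bigr => i _.
under eq_mean1 do rewrite incr_lin.
by rewrite mean1Z mean1B mean1_cst// Eu subr0.
Qed.

Lemma lin_sqvar c w : sqvar p (lin u c) w =
  \sum_i c i ^+ 2 * (u (w i) ^+ 2 + E' (fun a => u a ^+ 2)).
Proof.
apply: eq_bigr => i _; under eq_mean1 do rewrite incr_lin exprMn.
by rewrite mean1Z mean1_sqrB.
Qed.

Lemma mean_lin_sqr c :
  E (fun w => lin u c w ^+ 2) = (\sum_i c i ^+ 2) * E' (fun a => u a ^+ 2).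
Proof.
have two0 : (2 : R) != 0 by rewrite pnatr_eq0.
have /esym := mean_sqvar (lin_homogeneous c); rewrite mulr1.
under [in RHS]eq_mean do rewrite lin_sqvar.
rewrite mean_sum; under [in RHS]eq_bigr => i _ do
  rewrite meanZ meanD mean_cst// (mean_coord p_sum1 i (fun a => u a ^+ 2)) -mulr2n -mulr_natl mulrCA.
by rewrite -mulr_sumr => /(mulfI two0) ->; rewrite mulr_suml.
Qed.

(** In [mean_fourth_le] the variable sqvar / 2 is the sum of
    c_i^2 (u (w i)^2 + 1) / 2, whose square is at most
    (sum_i c_i^2) (sum_i c_i^2 ((u (w i)^2 + 1) / 2)^2). *)
Lemma mean_lin_fourth c : E' (fun a => u a ^+ 2) = 1 ->
  E (fun w => lin u c w ^+ 4) <=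
  9 / 4 * (E' (fun a => u a ^+ 4) + 3) * (\sum_i c i ^+ 2) ^+ 2.
Proof.
move=> u2; set q := \sum_i _.
have := mean_fourth_le p_ge0 ltr01 (lin_homogeneous c).
move=> /le_trans; apply; rewrite -!mulrA ler_pM2l//.
apply: (@le_trans _ _ (E (fun w => q * \sum_i c i ^+ 2 *
    (2^-1 * (u (w i) ^+ 2 + 1)) ^+ 2))).
  apply: le_mean => // w.
  have := sum_CauchySchwarz c (fun i => c i * (2^-1 * (u (w i) ^+ 2 + 1))).
  under [X in _ <= _ * X]eq_bigr do rewrite exprMn.
  apply: le_trans; rewrite lin_sqvar u2 mulr1 mulrC mulr_sumr.
  rewrite le_eqVlt (_ : (_ == _) = true)//; apply/eqP; congr (_ ^+ 2).
  by apply: eq_bigr => i _ /=; field.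
set m4 := E' (fun a => u a ^+ 4).
have -> : 4^-1 * ((m4 + 3) * q ^+ 2) = q * (q * (4^-1 * (m4 + 3))) by ring.
rewrite meanZ mean_sum ler_wpM2l//.
  by apply: sumr_ge0 => i _; rewrite sqr_ge0.
rewrite mulr_suml; apply: ler_sum => i _; rewrite meanZ ler_wpM2l ?sqr_ge0//.
rewrite (mean_coord p_sum1 i (fun a => (2^-1 * (u a ^+ 2 + 1)) ^+ 2)).
rewrite (_ : E' _ = E' (fun a => 4^-1 * (u a ^+ 4 + (2 * u a ^+ 2 + 1)))).
  by rewrite mean1Z !mean1D mean1Z mean1_cst// u2 mulr1 -/m4; lra.
by apply: eq_mean1 => a; field.
Qed.

End LinearForms.

(** * Quadratic forms in independent variables *)

Section QuadraticForms.
Variables (R : realFieldType) (I J : finType) (p v : I -> R).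
Hypothesis p_ge0 : forall a, 0 <= p a.
Hypothesis p_sum1 : \sum_a p a = 1.
Local Notation E := (mean p).
Local Notation E' := (mean1 p).
Hypothesis Ev : E' v = 0.
Hypothesis Ev2 : E' (fun a => v a ^+ 2) = 1.
Let m4 := E' (fun a => v a ^+ 4).

(** Jensen's inequality: v^4 >= 2 v^2 - 1. *)
Lemma fourth_ge1 : 1 <= m4.
Proof.
have : 0 <= E' (fun a => (v a ^+ 2 - 1) ^+ 2).
  by apply: mean1_ge0 => // a; rewrite sqr_ge0.
have -> : E' (fun a => (v a ^+ 2 - 1) ^+ 2) =
    E' (fun a => v a ^+ 4 + (- 2 * v a ^+ 2 + 1)).
  by apply: eq_mean1 => a; ring.
by rewrite !mean1D mean1Z mean1_cst// Ev2 -/m4; lra.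
Qed.

Section Form.
Variable b : J -> J -> R.
Hypothesis b_sym : forall i j, b i j = b j i.
Hypothesis b_diag : forall i, b i i = 0.

Definition quad (w : {ffun J -> I}) := \sum_i \sum_j b i j * v (w i) * v (w j).
Local Notation Y i := (lin v (b i)).
Local Notation q i := (\sum_j b i j ^+ 2).

Lemma free_lin_row i : free_of i (Y i).
Proof. exact: lin_free. Qed.

(** The form is bilinear in (x, x), and x is changed by d in the direction i: the
    term in d^2 has the coefficient b_ii = 0. *)
Lemma incr_quad i w a : incr quad i w a = 2 * (v (w i) - v a) * Y i w.
Proof.
set d := v (w i) - v a; pose e (j : J) : R := (j == i)%:R.
have sum_e (G : J -> R) : \sum_j G j * e j = G i.
  rewrite (bigD1 i)//= /e eqxx mulr1 big1 ?addr0// => j /negbTE ->.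
  by rewrite mulr0.
have ve j : v (upd w i a j) = v (w j) - d * e j.
  rewrite /e /d; have [->|ji] := eqVneq j i; first by rewrite upd_same mulr1 subKr.
  by rewrite upd_other// mulr0 subr0.
rewrite /incr /quad -sumrB.
transitivity (\sum_k ((d * \sum_j b k j * v (w j)) * e k +
    (d * v (w k) * b k i) - (d ^+ 2 * b k i) * e k)).
  apply: eq_bigr => k _; rewrite -sumrB -[b k i in RHS](sum_e (b k)) !mulr_sumr.
  rewrite !mulr_suml -big_split/= -sumrB; apply: eq_bigr => j _.
  by rewrite !ve; ring.
rewrite sumrB big_split/= !sum_e b_diag mulr0 subr0 /lin.
under [X in _ + X]eq_bigr do rewrite -mulrA [v _ * _]mulrC b_sym.
by rewrite -mulr_sumr; ring.
Qed.

Lemma quad_homogeneous : homogeneous p quad 2.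
Proof.
move=> w; under eq_bigr => i _.
  under eq_mean1 do rewrite incr_quad mulrAC.
  rewrite mean1Z mean1B mean1_cst// Ev subr0.
over.
rewrite /quad mulr_sumr; apply: eq_bigr => i _.
rewrite /lin -mulrA; congr (_ * _); rewrite mulr_suml.
by apply: eq_bigr => j _; ring.
Qed.

Lemma quad_sqvar w :
  sqvar p quad w = 4 * \sum_i (v (w i) ^+ 2 + 1) * Y i w ^+ 2.
Proof.
rewrite mulr_sumr; apply: eq_bigr => i _.
under eq_mean1 do rewrite incr_quad !exprMn mulrAC.
by rewrite mean1Z mean1_sqrB// Ev2; ring.
Qed.

Definition sgnsq (a : I) := E' (fun a' => `|v a - v a'| * (v a - v a')).

Lemma quad_sgnvar w :
  sgnvar p quad w = 4 * \sum_i sgnsq (w i) * (`|Y i w| * Y i w).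
Proof.
rewrite mulr_sumr; apply: eq_bigr => i _.
transitivity (4 * (`|Y i w| * Y i w) * sgnsq (w i)); last by ring.
rewrite -mean1Z; apply: eq_mean1 => a.
by rewrite incr_quad !normrM normr_nat; ring.
Qed.

Lemma mean_lin_row_sqr i : E (fun w => Y i w ^+ 2) = q i.
Proof. by rewrite mean_lin_sqr// Ev2 mulr1. Qed.

Lemma mean_quad_sqr : E (fun w => quad w ^+ 2) = 2 * \sum_i q i.
Proof.
have four0 : (2 * 2 : R) != 0 by rewrite mulf_neq0 ?pnatr_eq0.
apply: (mulfI four0); rewrite -(mean_sqvar quad_homogeneous).
under eq_mean do rewrite quad_sqvar.
rewrite meanZ mean_sum mulr_sumr [in RHS]mulr_sumr mulr_sumr.
apply: eq_bigr => i _.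
rewrite (@mean_indep _ _ _ _ p_sum1 i (fun a => v a ^+ 2 + 1) (fun w => Y i w ^+ 2)).
  by rewrite mean1D mean1_cst// Ev2 mean_lin_row_sqr; ring.
by move=> w a; rewrite free_lin_row.
Qed.

(** The second moment of sum_i psi(X_i) s(Y_i). With psi = v^2 - 1 and s the
    square it measures the fluctuations of [sqvar], with psi = [sgnsq] and
    s x = |x| x those of [sgnvar]. *)
Section WeightedSum.
Variables (psi : I -> R) (s : R -> R).
Hypothesis Epsi : E' psi = 0.
Hypothesis psi_le : forall a, `|psi a| <= v a ^+ 2 + 1.
Hypothesis s0 : s 0 = 0.
Hypothesis s_lip : forall x y, `|s x - s y| <= `|x - y| * (`|x| + `|y|).

(* U i j is Y i without its term in w j. *)
Let off i j (k : J) := if k == j then 0 else b i k.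
Local Notation U i j := (lin v (off i j)).

Let lin_row_split i j w : Y i w = U i j w + b i j * v (w j).
Proof.
rewrite /lin (bigD1 j)//= [in RHS](bigD1 j)//= /off eqxx mul0r add0r addrC.
by congr (_ + _); apply: eq_bigr => k /negbTE ->.
Qed.

Let free_offr i j : free_of j (U i j).
Proof. by apply: lin_free; rewrite /off eqxx. Qed.

Let free_offl i j : free_of i (U i j).
Proof. by apply: lin_free; rewrite /off b_diag if_same. Qed.

Let mean_off_sqr_le i j : E (fun w => U i j w ^+ 2) <= q i.
Proof.
rewrite mean_lin_sqr// Ev2 mulr1; apply: ler_sum => k _.
by rewrite /off; case: eqP => // _; rewrite expr0n/= sqr_ge0.
Qed.

Let h (x : R) := (x ^+ 2 + 1) * (`|x| * (1 + `|x|)).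

Let mean_h_le : E' (fun a => h (v a)) <= 6 * m4.
Proof.
have := fourth_ge1 => m41.
apply: (@le_trans _ _ (E' (fun a => 2 * v a ^+ 4 + (3 * v a ^+ 2 + 1)))).
  apply: le_mean1 => // a; rewrite /h; set x := v a.
  rewrite (exprM x 2 2) -(real_normK (num_real x)).
  have := normr_ge0 x; set y := `|x| => y0.
  rewrite -subr_ge0 (_ : _ - _ = (1 + y ^+ 2) * ((y - 2^-1) ^+ 2 + 3 / 4)); last by field.
  by rewrite mulr_ge0 ?addr_ge0 ?sqr_ge0 ?divr_ge0 ?ler0n.
by rewrite !mean1D !mean1Z mean1_cst// Ev2 -/m4; lra.
Qed.

(* Products are separated into squares for u and w only: doing so for x and y
   too would produce x^5 and y^5, beyond the available moments. *)
Let cross_pointwise (x y u w c f1 f2 d1 d2 : R) :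
  `|f1| <= x ^+ 2 + 1 -> `|f2| <= y ^+ 2 + 1 ->
  `|d1| <= `|c * y| * (2 * `|u| + `|c * y|) ->
  `|d2| <= `|c * x| * (2 * `|w| + `|c * x|) ->
  f1 * f2 * (d1 * d2) <= h x * (h y * (c ^+ 2 * (2 * u ^+ 2 + 2 * w ^+ 2 + c ^+ 2))).
Proof.
move=> hf1 hf2 hd1 hd2.
apply: le_trans (ler_norm _) _; rewrite !normrM.
apply: (@le_trans _ _ ((x ^+ 2 + 1) * (y ^+ 2 + 1) *
   ((`|c * y| * (2 * `|u| + `|c * y|)) * (`|c * x| * (2 * `|w| + `|c * x|))))).
  by rewrite !ler_pM ?mulr_ge0.
rewrite /h !normrM -(real_normK (num_real u)) -(real_normK (num_real w)).
rewrite -(real_normK (num_real c)).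
move: (normr_ge0 x) (normr_ge0 y) (normr_ge0 u) (normr_ge0 w) (normr_ge0 c).
move: (sqr_ge0 x) (sqr_ge0 y).
set X := x ^+ 2; set Z := y ^+ 2.
move: `|x| `|y| `|u| `|w| `|c| => P Q A B C X0 Z0 P0 Q0 A0 B0 C0.
rewrite -subr_ge0.
have -> : (X + 1) * (P * (1 + P)) * ((Z + 1) * (Q * (1 + Q)) *
    (C ^+ 2 * (2 * A ^+ 2 + 2 * B ^+ 2 + C ^+ 2))) -
  (X + 1) * (Z + 1) * (C * Q * (2 * A + C * Q) * (C * P * (2 * B + C * P))) =
  ((X + 1) * (Z + 1) * (P * Q) * C ^+ 2) *
   (2 * (A - B) ^+ 2 + C ^+ 2 + P * ((A - C) ^+ 2 + A ^+ 2 + 2 * B ^+ 2) +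
    Q * ((B - C) ^+ 2 + 2 * A ^+ 2 + B ^+ 2) +
    2 * (P * Q) * (A ^+ 2 + B ^+ 2)) by ring.
by do ?[exact: sqr_ge0 | exact: ler0n | assumption | exact: ler01
  | apply: mulr_ge0 | apply: addr_ge0].
Qed.

(* Since psi is centred, means of products in which s (Y i) or s (Y j) is
   replaced by s (U i j) or s (U j i) vanish. Hence both may be replaced by their
   differences, each of which carries a factor b_ij. *)
Let off_diagonal_le i j : i != j ->
  E (fun w => psi (w i) * s (Y i w) * (psi (w j) * s (Y j w))) <=
  36 * m4 ^+ 2 * (b i j ^+ 2 * (3 * q i + 2 * q j)).
Proof.
move=> ij.
pose D i j w := s (Y i w) - s (U i j w).
have -> : E (fun w => psi (w i) * s (Y i w) * (psi (w j) * s (Y j w))) =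
    E (fun w => psi (w i) * psi (w j) * (D i j w * D j i w)).
  transitivity (E (fun w => psi (w i) * psi (w j) * (D i j w * D j i w)) +
   (E (fun w => psi (w j) * (psi (w i) * s (U i j w) * s (Y j w))) +
    E (fun w => psi (w i) * (psi (w j) * s (Y i w) * s (U j i w))) -
    E (fun w => psi (w i) * (psi (w j) * s (U i j w) * s (U j i w))))).
    by rewrite -!meanD -meanB -meanD; apply: eq_mean => w; rewrite /D; ring.
  rewrite (mean_indep (i := j) p_sum1 psi); last first.
    by move=> w a; rewrite upd_other// free_offr free_lin_row.
  rewrite !(mean_indep (i := i) p_sum1 psi).
  - by rewrite Epsi !mul0r !addr0 subrr addr0.
  - by move=> w a; rewrite upd_other 1?eq_sym// free_offr free_offl.
  - by move=> w a; rewrite upd_other 1?eq_sym// free_offr free_lin_row.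
have D_le k l w : `|D k l w| <= `|b k l * v (w l)| * (2 * `|U k l w| + `|b k l * v (w l)|).
  apply: le_trans (s_lip _ _) _; rewrite (lin_row_split k l) addrAC subrr add0r.
  rewrite ler_wpM2l// mulr_natl mulr2n [leRHS]addrAC lerD2r.
  exact: ler_normD.
apply: (@le_trans _ _ (E (fun w => h (v (w i)) * (h (v (w j)) * (b i j ^+ 2 *
    (2 * U i j w ^+ 2 + 2 * U j i w ^+ 2 + b i j ^+ 2)))))).
  apply: le_mean => // w; apply: cross_pointwise; rewrite ?psi_le//.
  by rewrite (b_sym i j).
rewrite (mean_indep (i := i) p_sum1 (fun a => h (v a))); last first.
  by move=> w a; rewrite upd_other 1?eq_sym// free_offr free_offl.
rewrite (mean_indep (i := j) p_sum1 (fun a => h (v a))); last first.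
  by move=> w a; rewrite free_offr free_offl.
rewrite meanZ !meanD !meanZ mean_cst//.
set H := E' _; have H0 : 0 <= H.
  by apply: mean1_ge0 => // a; rewrite !mulr_ge0 ?addr_ge0 ?sqr_ge0.
have bq : b i j ^+ 2 <= q i.
  by rewrite (bigD1 j)//= lerDl sumr_ge0// => k _; rewrite sqr_ge0.
rewrite mulrA -expr2 (_ : 36 * _ = (6 * m4) ^+ 2); last by ring.
apply: ler_pM; rewrite ?sqr_ge0//.
- by do ?[exact: sqr_ge0 | exact: ler0n | apply: mulr_ge0 | apply: addr_ge0
  | apply: mean_ge0 => // w].
- by rewrite ler_sqr ?nnegrE ?mean_h_le// (le_trans H0) ?mean_h_le.
rewrite ler_wpM2l ?sqr_ge0//.
by have := mean_off_sqr_le i j; have := mean_off_sqr_le j i; lra.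
Qed.

Let diagonal_le i :
  E (fun w => (psi (w i) * s (Y i w)) ^+ 2) <= 36 * m4 ^+ 2 * q i ^+ 2.
Proof.
have := fourth_ge1 => m41.
apply: (@le_trans _ _ (E (fun w => (v (w i) ^+ 2 + 1) ^+ 2 * Y i w ^+ 4))).
  apply: le_mean => // w; rewrite -real_normK ?num_real// normrM exprMn.
  apply: ler_pM; rewrite ?sqr_ge0 ?exprn_ge0// ?lerXn2r ?nnegrE ?addr_ge0 ?sqr_ge0//.
  rewrite (exprM _ 2 2) -(real_normK (num_real (Y i w))).
  have := s_lip (Y i w) 0; rewrite s0 !subr0 normr0 addr0 -expr2 => sY.
  by rewrite ler_sqr ?nnegrE ?sqr_ge0.
rewrite (mean_indep (i := i) p_sum1 (fun a => (v a ^+ 2 + 1) ^+ 2)); last first.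
  by move=> w a; rewrite free_lin_row.
have -> : E' (fun a => (v a ^+ 2 + 1) ^+ 2) = m4 + 3.
  rewrite (_ : E' _ = E' (fun a => v a ^+ 4 + (2 * v a ^+ 2 + 1))).
    by rewrite !mean1D mean1Z mean1_cst// Ev2 -/m4; lra.
  by apply: eq_mean1 => a; ring.
have := mean_lin_fourth p_ge0 p_sum1 Ev (b i) Ev2; rewrite -/m4 => h4.
apply: (@le_trans _ _ ((m4 + 3) * (9 / 4 * (m4 + 3) * q i ^+ 2))).
  by rewrite ler_wpM2l// addr_ge0// (le_trans ler01).
rewrite mulrA ler_wpM2r ?sqr_ge0//.
rewrite -subr_ge0 (_ : _ - _ = 9 / 4 * ((m4 - 1) * (15 * m4 + 9))); last by field.
by rewrite !mulr_ge0 ?divr_ge0 ?ler0n// ?subr_ge0//; lra.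
Qed.

(** The off-diagonal terms sum to a multiple of
    sum_(i,j) b_ij^2 (q_i + q_j) = 2 sum_i q_i^2. *)
Lemma mean_weighted_sum_sqr_le :
  E (fun w => (\sum_i psi (w i) * s (Y i w)) ^+ 2) <=
  6 ^+ 3 * m4 ^+ 2 * \sum_i q i ^+ 2.
Proof.
pose T i (w : {ffun J -> I}) := psi (w i) * s (Y i w).
have -> : E (fun w => (\sum_i T i w) ^+ 2) =
    \sum_i \sum_j E (fun w => T i w * T j w).
  under [RHS]eq_bigr do rewrite -mean_sum.
  rewrite -mean_sum; apply: eq_mean => w.
  by rewrite expr2 mulr_suml; apply: eq_bigr => i _; rewrite mulr_sumr.
have m0 : 0 <= 36 * m4 ^+ 2 by rewrite mulr_ge0 ?sqr_ge0.
have le_ij i j : E (fun w => T i w * T j w) <= 36 * m4 ^+ 2 *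
    ((j == i)%:R * q i ^+ 2 + b i j ^+ 2 * (3 * q i + 2 * q j)).
  have [->|ji] := eqVneq j i.
    by rewrite b_diag expr0n mul0r addr0 mul1r; exact: diagonal_le.
  by rewrite mul0r add0r; apply: off_diagonal_le; rewrite eq_sym.
apply: le_trans (ler_sum _ (fun i _ => ler_sum _ (fun j _ => le_ij i j))) _.
under eq_bigr do rewrite -mulr_sumr.
rewrite -mulr_sumr.
have -> : \sum_i \sum_j ((j == i)%:R * q i ^+ 2 +
    b i j ^+ 2 * (3 * q i + 2 * q j)) = 6 * \sum_i q i ^+ 2.
  transitivity (\sum_i (q i ^+ 2 + 3 * q i ^+ 2) +
      \sum_i \sum_j b i j ^+ 2 * (2 * q j)).
    rewrite -big_split; apply: eq_bigr => i _ /=.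
    have d1 : \sum_(j : J) (j == i)%:R = 1 :> R.
      by rewrite (bigD1 i)//= eqxx big1 ?addr0// => j /negbTE ->.
    under [LHS]eq_bigr do rewrite mulrDr addrA.
    rewrite !big_split/= -!mulr_suml d1 mul1r; congr (_ + _ + _).
    by rewrite mulrCA.
  rewrite exchange_big big_split/= -mulr_sumr.
  rewrite [X in _ + X](eq_bigr (fun i => 2 * q i ^+ 2)) => [|j _].
    by rewrite -mulr_sumr; ring.
  rewrite -mulr_suml mulrCA; congr (_ * (_ * _)).
  by apply: eq_bigr => i _; rewrite b_sym.
by rewrite le_eqVlt; apply/orP; left; apply/eqP; ring.
Qed.
End WeightedSum.
End Form.
End QuadraticForms.

(** * The bound for finitely supported variables *)

Lemma signed_square_lip (R : realDomainType) (x y : R) :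
  `| `|x| * x - `|y| * y | <= `|x - y| * (`|x| + `|y|).
Proof.
wlog yx : x y / y <= x => [H|].
  have [|/ltW xy] := leP y x; first exact: H.
  by rewrite distrC [`|x - y|]distrC [`|x| + _]addrC; exact: H.
rewrite [`|x - y|]ger0_norm ?subr_ge0//.
have [x0|x0] := leP 0 x; have [y0|y0] := leP 0 y.
- rewrite (ger0_norm x0) (ger0_norm y0) ger0_norm; first by rewrite le_eqVlt; apply/orP; left; apply/eqP; ring.
  by rewrite subr_ge0 ler_pM.
- rewrite (ger0_norm x0) (ltr0_norm y0) ger0_norm; last by nra.
  by nra.
- by have := le_lt_trans y0 (le_lt_trans yx x0); rewrite ltxx.
- rewrite (ltr0_norm x0) (ltr0_norm y0) ger0_norm; last by nra.
  by nra.
Qed.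

Section QuadraticFormBound.
Variables (R : realFieldType) (I J : finType) (p v : I -> R).
Hypothesis p_ge0 : forall a, 0 <= p a.
Hypothesis p_sum1 : \sum_a p a = 1.
Local Notation E := (mean p).
Local Notation E' := (mean1 p).
Hypothesis Ev : E' v = 0.
Hypothesis Ev2 : E' (fun a => v a ^+ 2) = 1.
Let m4 := E' (fun a => v a ^+ 4).
Variable b : J -> J -> R.
Hypothesis b_sym : forall i j, b i j = b j i.
Hypothesis b_diag : forall i, b i i = 0.
Hypothesis b_norm : 2 * \sum_i \sum_j b i j ^+ 2 = 1.
Local Notation Y i := (lin v (b i)).
Local Notation q i := (\sum_j b i j ^+ 2).
Local Notation W := (quad v b).

Definition gram i j := \sum_k b i k * b j k.

(** The second sum is the trace of b^4. *)
Definition spread := \sum_i q i ^+ 2 + \sum_i \sum_j gram i j ^+ 2.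

Let m41 : 1 <= m4. Proof. exact: fourth_ge1. Qed.

Let q_ge0 i : 0 <= q i. Proof. by apply: sumr_ge0 => j _; rewrite sqr_ge0. Qed.
Let q2_ge0 : 0 <= \sum_i q i ^+ 2.
Proof. by apply: sumr_ge0 => i _; rewrite sqr_ge0. Qed.
Let gram2_ge0 : 0 <= \sum_i \sum_j gram i j ^+ 2.
Proof. by apply: sumr_ge0 => i _; apply: sumr_ge0 => j _; rewrite sqr_ge0. Qed.

(** Each of the sums is at most (sum_i q i)^2 = 1/4. *)
Lemma spread_le : spread <= 2^-1.
Proof.
have s0 : \sum_i q i = 2^-1 by move: b_norm; set s := \sum_i _; lra.
have e : \sum_i \sum_j q i * q j = 4^-1.
  under eq_bigr do rewrite -mulr_sumr.
  by rewrite -mulr_suml s0; field.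
have g2 : \sum_i \sum_j gram i j ^+ 2 <= 4^-1.
  rewrite -e; apply: ler_sum => i _; apply: ler_sum => j _.
  exact: sum_CauchySchwarz.
have q2 : \sum_i q i ^+ 2 <= 4^-1.
  rewrite -e; apply: ler_sum => i _; rewrite [leRHS](bigD1 i)//= -expr2 lerDl.
  by apply: sumr_ge0 => j _; rewrite mulr_ge0.
by rewrite /spread; lra.
Qed.

Lemma mean_sgnsq : E' (sgnsq p v) = 0.
Proof.
have : E' (sgnsq p v) = - E' (sgnsq p v).
  rewrite -[RHS]mean1N /sgnsq /mean1.
  under eq_bigr do rewrite mulr_sumr.
  rewrite exchange_big; apply: eq_bigr => a _ /=.
  rewrite -sumrN mulr_sumr; apply: eq_bigr => c _.
  by rewrite distrC; ring.
by move: (E' _) => x; lra.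
Qed.

Lemma sgnsq_le a : `|sgnsq p v a| <= v a ^+ 2 + 1.
Proof.
rewrite -Ev2 -(mean1_sqrB p_sum1 Ev); apply: le_trans (normr_mean1_le p_ge0 _) _.
by apply: le_mean1 => // c; rewrite normrM normr_id -expr2 real_normK ?num_real.
Qed.

Lemma mean_quad_sgnvar_sqr_le :
  E (fun w => (sgnvar p W w / 2) ^+ 2) <= (30 * m4) ^+ 2 * spread.
Proof.
have := mean_weighted_sum_sqr_le p_ge0 p_sum1 Ev Ev2 b_sym b_diag mean_sgnsq
  sgnsq_le (s := fun x => `|x| * x).
rewrite mulr0 -/m4 => /(_ erefl (@signed_square_lip R)) h.
apply: (@le_trans _ _ (4 * (6 ^+ 3 * m4 ^+ 2 * \sum_i q i ^+ 2))).
  rewrite -(ler_pM2l (ltr0n R 4 : 0 < 4)) in h; apply: le_trans h.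
  rewrite -meanZ le_eqVlt; apply/orP; left; apply/eqP; apply: eq_mean => w.
  by rewrite quad_sgnvar//; field.
have := mulr_ge0 (sqr_ge0 m4) q2_ge0; have := mulr_ge0 (sqr_ge0 m4) gram2_ge0.
by rewrite /spread -!mulrA mulrDr; lra.
Qed.

Let off k l := if k == l then 0 else gram k l.

(* The sum of the Y i ^+ 2 is a quadratic form with matrix gram, whose diagonal
   part is a linear form in the v^2. *)
Let sqvar_split w : sqvar p W w / (2 * 2) - 1 =
  2 * quad v off w + 2 * lin (fun a => v a ^+ 2 - 1) (fun k => q k) w +
  \sum_i (v (w i) ^+ 2 - 1) * Y i w ^+ 2.
Proof.
rewrite quad_sqvar//.
have -> : \sum_i (v (w i) ^+ 2 + 1) * Y i w ^+ 2 =
    \sum_i (v (w i) ^+ 2 - 1) * Y i w ^+ 2 + 2 * \sum_i Y i w ^+ 2.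
  by rewrite mulr_sumr -big_split; apply: eq_bigr => i _ /=; ring.
have -> : \sum_i Y i w ^+ 2 = quad v off w + \sum_k q k * v (w k) ^+ 2.
  have -> : \sum_i Y i w ^+ 2 = \sum_k \sum_l gram k l * v (w k) * v (w l).
    transitivity (\sum_i \sum_k \sum_l (b k i * b l i) * v (w k) * v (w l)).
      apply: eq_bigr => i _; rewrite expr2 mulr_suml; apply: eq_bigr => k _.
      rewrite mulr_sumr; apply: eq_bigr => l _.
      by rewrite (b_sym i k) (b_sym i l); ring.
    rewrite exchange_big; apply: eq_bigr => k _.
    rewrite exchange_big; apply: eq_bigr => l _.
    by rewrite /gram !mulr_suml.
  rewrite -big_split; apply: eq_bigr => k _ /=.
  rewrite (bigD1 k)//= [in RHS](bigD1 k)//= /off eqxx !mul0r add0r addrC.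
  congr (_ + _); first by apply: eq_bigr => l; rewrite eq_sym => /negbTE ->.
  by rewrite -mulrA -expr2; congr (_ * _); apply: eq_bigr => j _; rewrite expr2.
have -> : lin (fun a => v a ^+ 2 - 1) (fun k => q k) w =
    \sum_k q k * v (w k) ^+ 2 - \sum_k q k.
  by rewrite -sumrB; apply: eq_bigr => k _; rewrite mulrBr mulr1.
by have := b_norm; set s := \sum_i \sum_j _ ^+ 2; move=> bn; lra.
Qed.

Lemma mean_quad_sqvar_dev_le :
  E (fun w => (1 - sqvar p W w / (2 * 2)) ^+ 2) <= (30 * m4) ^+ 2 * spread.
Proof.
pose psi a := v a ^+ 2 - 1.
have Epsi : E' psi = 0 by rewrite mean1B mean1_cst// Ev2 subrr.
have psi_le a : `|psi a| <= v a ^+ 2 + 1.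
  by rewrite ler_norml /psi; have := sqr_ge0 (v a); lra.
have sq_lip (x y : R) : `|x ^+ 2 - y ^+ 2| <= `|x - y| * (`|x| + `|y|).
  by rewrite subr_sqr normrM ler_wpM2l// ler_normD.
have := mean_weighted_sum_sqr_le p_ge0 p_sum1 Ev Ev2 b_sym b_diag Epsi
  psi_le (s := fun x => x ^+ 2).
rewrite expr0n -/m4 => /(_ erefl sq_lip) h3.
have off_sym i j : off i j = off j i.
  rewrite /off eq_sym; case: eqP => // _.
  by apply: eq_bigr => k _; rewrite mulrC.
have off_diag i : off i i = 0 by rewrite /off eqxx.
have h1 := mean_quad_sqr p_sum1 Ev Ev2 off_sym off_diag.
have h2 := mean_lin_sqr p_sum1 Epsi (fun k : J => q k).
have psi2 : E' (fun a => psi a ^+ 2) = m4 - 1.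
  rewrite (_ : E' _ = E' (fun a => v a ^+ 4 + (- 2 * v a ^+ 2 + 1))).
    by rewrite !mean1D mean1Z mean1_cst// Ev2 -/m4; lra.
  by apply: eq_mean1 => a; rewrite /psi; ring.
have off_le : \sum_i \sum_j off i j ^+ 2 <= \sum_i \sum_j gram i j ^+ 2.
  apply: ler_sum => i _; apply: ler_sum => j _; rewrite /off.
  by case: eqP => // _; rewrite expr0n sqr_ge0.
apply: (@le_trans _ _ (12 * E (fun w => quad v off w ^+ 2) +
   (12 * E (fun w => lin psi (fun k : J => q k) w ^+ 2) +
   3 * E (fun w => (\sum_i psi (w i) * Y i w ^+ 2) ^+ 2)))).
  rewrite -!meanZ -!meanD; apply: le_mean => // w.
  rewrite -sqrrN opprB sqvar_split -/psi.
  set x := quad _ _ _; set y := lin _ _ _; set u := \sum_i _.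
  have := sqr_ge0 (2 * x - 2 * y); have := sqr_ge0 (2 * x - u).
  by have := sqr_ge0 (2 * y - u); lra.
rewrite h1 h2 psi2; move: h3 off_le gram2_ge0 q2_ge0 m41; rewrite /spread.
set B := \sum_i _ ^+ 2; set G := \sum_i \sum_j gram _ _ ^+ 2.
set O := \sum_i \sum_j off _ _ ^+ 2; set T := E _ => h3 h4 G0 B0 m1.
have mB : m4 * B <= m4 ^+ 2 * B by rewrite ler_wpM2r//; nra.
have mG : G <= m4 ^+ 2 * G by rewrite ler_peMl//; nra.
have mB0 : 0 <= m4 ^+ 2 * B by rewrite mulr_ge0// sqr_ge0.
lra.
Qed.

Lemma mean_quad_fourth_le : E (fun w => W w ^+ 4) <= 10 ^+ 4 * m4 ^+ 2.
Proof.
have h2 : (0 : R) < 2 by [].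
have := mean_fourth_le p_ge0 h2 (quad_homogeneous p_sum1 Ev b_sym b_diag).
move=> /le_trans; apply.
have : E (fun w => (sqvar p W w / (2 * 2)) ^+ 2) <=
    2 + 2 * E (fun w => (1 - sqvar p W w / (2 * 2)) ^+ 2).
  rewrite -meanZ -[X in X + _](mean_cst J p_sum1) -meanD.
  apply: le_mean => // w; set x := _ / _.
  by have := sqr_ge0 (2 - x); lra.
have := mean_quad_sqvar_dev_le; have := spread_le.
have mm : 1 <= m4 ^+ 2 by rewrite exprn_ege1.
set x := E _; set y := E _ => sl h.
have : m4 ^+ 2 * spread <= m4 ^+ 2 * 2^-1 by rewrite ler_wpM2l// sqr_ge0.
by lra.
Qed.

(** Markov's inequality for (1 + 2 |W|)^4. *)
Lemma quad_tail_le (z : R) :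
  E (fun w => (`|z| / 2 < `|W w|)%R%:R) <= (10 ^+ 4 * m4 / (1 + `|z|) ^+ 2) ^+ 2.
Proof.
have z0 : 0 < 1 + `|z| by rewrite ltr_wpDr.
apply: (@le_trans _ _ (E (fun w => ((1 + `|z|) ^+ 4)^-1 * (8 * (1 + 16 * W w ^+ 4))))).
  apply: le_mean => // w; case: ltP => [zW|_]; last first.
    apply: mulr_ge0; first by rewrite invr_ge0 exprn_ge0// ltW.
    by rewrite mulr_ge0// addr_ge0// mulr_ge0// (exprM _ 2 2) sqr_ge0.
  rewrite mulrC ler_pdivlMr ?exprn_gt0// mul1r.
  rewrite (exprM (W w) 2 2) -(real_normK (num_real (W w))) -exprM.
  set u := `|W w| in zW *; set y := `|z| in zW z0 *.
  have y0 : 0 <= y by rewrite normr_ge0.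
  apply: (@le_trans _ _ ((1 + 2 * u) ^+ 4)).
    rewrite lerXn2r ?nnegrE ?ltW//; first by apply: lt_trans z0 _; lra.
    by lra.
  rewrite -subr_ge0.
  have -> : 8 * (1 + 16 * u ^+ (2 * 2)) - (1 + 2 * u) ^+ 4 =
    ((1 - 2 * u) ^+ 2) * (5 * (1 + 2 * u) ^+ 2 + 2 + 2 * (2 * u) ^+ 2) by ring.
  by do ?[exact: sqr_ge0 | exact: ler0n | apply: mulr_ge0 | apply: addr_ge0].
rewrite meanZ meanZ meanD mean_cst// meanZ exprMn exprVn -exprM mulrC.
rewrite ler_wpM2r ?invr_ge0 ?exprn_ge0 ?ltW// exprMn.
have := mean_quad_fourth_le; have : 1 <= m4 ^+ 2 by rewrite exprn_ege1.
set x := E _; lra.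
Qed.

Section Stein.
Variables (f g : R -> R) (z t r : R).
Hypothesis fg : forall u, g u = u * f u.
Hypothesis g_mono : {homo g : a b / a <= b}.
Hypothesis f_incr : forall a b : R, a <= b ->
  (b - a) * (g a + (b <= z)%R%:R - t) <= f b - f a <=
  (b - a) * (g b + (a <= z)%R%:R - t).
Hypothesis g_le1 : forall u, `|g u| <= 1.
Hypothesis f'_le1 : forall u, `|g u + (u <= z)%R%:R - t| <= 1.
Hypothesis g_small : forall u, `|u| <= `|z| / 2 -> `|g u| <= 10 / (1 + `|z|) ^+ 2.
Hypothesis f'_small : forall u, `|u| <= `|z| / 2 ->
  `|g u + (u <= z)%R%:R - t| <= 10 / (1 + `|z|) ^+ 2.
Hypothesis r_gt0 : 0 < r.
Hypothesis spread_r : spread <= r ^+ 2.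

(** Where |W| <= |z| / 2, the bounds [g_small] and [f'_small] supply the decay in
    z; on the complement T it comes from [quad_tail_le] by the Cauchy-Schwarz
    inequality. *)
Theorem quad_nonuniform_bound :
  `|E (fun w => (W w <= z)%R%:R) - t| <= 10 ^+ 6 * m4 ^+ 2 * r / (1 + `|z|) ^+ 2.
Proof.
have z0 : 0 < 1 + `|z| by rewrite ltr_wpDr.
have m0 : 0 < m4 by apply: lt_le_trans m41.
pose beta : R := 10 / (1 + `|z|) ^+ 2.
have beta0 : 0 <= beta by rewrite divr_ge0// exprn_ge0// ltW.
pose T w : R := (`|z| / 2 < `|W w|)%R%:R.
pose a := 30 * m4 * r; pose tau := 10 ^+ 4 * m4 / (1 + `|z|) ^+ 2.
have a0 : 0 < a by rewrite !mulr_gt0.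
have tau0 : 0 < tau by rewrite divr_gt0 ?exprn_gt0// mulr_gt0 ?exprn_gt0.
have TE : E (fun w => T w ^+ 2) <= tau ^+ 2.
  apply: le_trans (quad_tail_le z); apply: le_mean => // w.
  by rewrite /T; case: (_ < _); rewrite ?expr1n ?expr0n.
have one : E (fun _ : {ffun J -> I} => 1 ^+ 2) <= 1 ^+ 2.
  by rewrite mean_cst.
have a2 : (30 * m4) ^+ 2 * spread <= a ^+ 2.
  by rewrite /a [leRHS]exprMn ler_wpM2l ?sqr_ge0.
have CS (F : {ffun J -> I} -> R) : E (fun w => F w ^+ 2) <= (30 * m4) ^+ 2 * spread ->
    E (fun w => `|F w|) <= a /\ E (fun w => T w * `|F w|) <= tau * a.
  move=> /le_trans/(_ a2) Fa; split.
    have := mean_CauchySchwarz p_ge0 a0 ltr01 Fa one; rewrite mulr1.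
    by apply: le_trans; apply: le_mean => // w; rewrite normr1 mulr1.
  have := mean_CauchySchwarz p_ge0 tau0 a0 TE Fa.
  by apply: le_trans; apply: le_mean => // w; rewrite /T normr_nat.
have [D1 D2] := CS _ mean_quad_sqvar_dev_le.
have [G1 G2] := CS _ mean_quad_sgnvar_sqr_le.
have split2 (k F : {ffun J -> I} -> R) : (forall w, `|k w| <= beta + T w) ->
    E (fun w => `|F w|) <= a /\ E (fun w => T w * `|F w|) <= tau * a ->
    E (fun w => `|k w| * `|F w|) <= beta * a + tau * a.
  move=> kb [F1 F2]; apply: (@le_trans _ _ (beta * E (fun w => `|F w|) +
      E (fun w => T w * `|F w|))).
    rewrite -meanZ -meanD; apply: le_mean => // w; rewrite -mulrDl.
    by rewrite ler_wpM2r.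
  by rewrite lerD// ler_wpM2l.
have small (k : R -> R) : (forall u, `|k u| <= 1) ->
    (forall u, `|u| <= `|z| / 2 -> `|k u| <= beta) ->
    forall w, `|k (W w)| <= beta + T w.
  move=> k1 kb w; rewrite /T; case: ltP => [_|/kb]; last by rewrite addr0.
  by apply: le_trans (k1 _) _; rewrite lerDr.
have := exchangeable_pair_bound p_ge0 p_sum1 fg g_mono f_incr (ltr0n R 2 : 0 < 2)
  (quad_homogeneous p_sum1 Ev b_sym b_diag).
move=> /le_trans; apply.
have B1 := split2 _ _ (small _ f'_le1 f'_small) (conj D1 D2).
have B2 := split2 _ _ (small _ g_le1 g_small) (conj G1 G2).
have B3 : `|E (fun w => (W w <= z)%R%:R * (sgnvar p W w / 2))| <= tau * a.
  apply: le_trans G2.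
  have [z_ge0|z_lt0] := leP 0 z; last first.
    apply: le_trans (normr_mean_le p_ge0 _) _; apply: le_mean => // w.
    rewrite normrM normr_nat ler_wpM2r// /T ler_nat.
    have [Wz|//] := leP (W w) z; rewrite (_ : `|z| / 2 < `|W w|)//.
    by rewrite !ltr0_norm//; lra.
  (* For z >= 0 the event W <= z need not lie in T, but its complement
     does, and sgnvar has mean zero. *)
  have -> : E (fun w => (W w <= z)%R%:R * (sgnvar p W w / 2)) =
      - E (fun w => (z < W w)%R%:R * (sgnvar p W w / 2)).
    have := mean_sgnvar0 p_sum1 W => G0.
    rewrite -[RHS]add0r -[in RHS](mul0r 2^-1) -[in RHS]G0 [in RHS]mulrC.
    rewrite -meanZ -meanB; apply: eq_mean => w.
    by case: leP => _; rewrite ?mul1r ?mul0r; field.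
  rewrite normrN; apply: le_trans (normr_mean_le p_ge0 _) _; apply: le_mean => // w.
  rewrite normrM normr_nat ler_wpM2r// /T ler_nat.
  have [//|zW] := leP (W w) z; rewrite (_ : `|z| / 2 < `|W w|)//.
  by rewrite !ger0_norm//; lra.
have -> : 10 ^+ 6 * m4 ^+ 2 * r / (1 + `|z|) ^+ 2 =
  2 * beta * a + 3 * tau * a + (10 ^+ 5 * m4 - 600) * m4 * r / (1 + `|z|) ^+ 2.
  by rewrite /beta /a /tau; field; rewrite gt_eqF.
have : 0 <= (10 ^+ 5 * m4 - 600) * m4 * r / (1 + `|z|) ^+ 2.
  apply: divr_ge0; last by rewrite exprn_ge0// ltW.
  do 2 (apply: mulr_ge0; last exact: ltW).
  by move: m41; lra.
by move: B1 B2 B3; lra.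
Qed.
End Stein.
End QuadraticFormBound.

(** * The standard normal distribution *)

Section Derivatives.
Variable R : realType.
Implicit Types (f g df dg : R -> R) (x : R).

(** [phi], [Phi] and [mills] are differentiable on the whole line, so that their
    derivatives can be composed without carrying the point along. *)
Definition has_deriv f df := forall x, is_derive x 1 f (df x).

Lemma has_deriv_continuous f df : has_deriv f df -> continuous f.
Proof.
move=> H x; apply/differentiable_continuous/derivable1_diffP.
by have [] := H x.
Qed.

Lemma has_deriv_MVT f df (a b : R) : has_deriv f df -> a <= b ->
  exists2 c, a <= c <= b & f b - f a = df c * (b - a).
Proof.
move=> H ab.
have [|c cab ->] := @MVT_segment R f df a b ab (fun x _ => H x).
  by apply: continuous_subspaceT => x; exact: (has_deriv_continuous H).
by exists c => //; rewrite in_itv/= in cab.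
Qed.

Lemma has_deriv_le f df (a b : R) : has_deriv f df -> a <= b ->
  (forall x, a <= x <= b -> 0 <= df x) -> f a <= f b.
Proof.
move=> H ab df0; have [c /df0 cab e] := has_deriv_MVT H ab.
by rewrite -subr_ge0 e mulr_ge0// subr_ge0.
Qed.

Lemma has_derivM f g df dg : has_deriv f df -> has_deriv g dg ->
  has_deriv (fun x => f x * g x) (fun x => f x * dg x + g x * df x).
Proof. by move=> Hf Hg x; exact: is_deriveM. Qed.

Lemma has_derivD f g df dg : has_deriv f df -> has_deriv g dg ->
  has_deriv (fun x => f x + g x) (fun x => df x + dg x).
Proof. by move=> Hf Hg x; exact: is_deriveD. Qed.

Lemma has_derivN f df : has_deriv f df ->
  has_deriv (fun x => - f x) (fun x => - df x).
Proof. by move=> Hf x; exact: is_deriveN. Qed.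

Lemma has_deriv_id : has_deriv id (fun=> 1).
Proof. by move=> x; exact: is_derive_id. Qed.

Lemma has_deriv_cst (c : R) : has_deriv (fun=> c) (fun=> 0).
Proof. by move=> x; exact: is_derive_cst. Qed.

Lemma has_deriv_comp f g df dg : has_deriv f df -> has_deriv g dg ->
  has_deriv (fun x => f (g x)) (fun x => df (g x) * dg x).
Proof. by move=> Hf Hg x; exact: is_derive1_comp. Qed.

Lemma has_deriv_opp f df : has_deriv f df ->
  has_deriv (fun x => f (- x)) (fun x => - df (- x)).
Proof.
move=> Hf x; have := has_deriv_comp Hf (has_derivN has_deriv_id) x.
by rewrite /= mulrN1.
Qed.

Lemma has_deriv_expR : has_deriv expR expR.
Proof. by move=> x; exact: is_derive_expR. Qed.

Lemma has_deriv_eq f df df' : has_deriv f df -> df =1 df' -> has_deriv f df'.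
Proof. by move=> H e x; rewrite -e. Qed.

End Derivatives.

Section NormalDistribution.
Variable R : realType.
Implicit Types x y : R.
Local Notation Phi := (@Phi R).

Definition phi x : R := normal_pdf 0 1 x.

Lemma phiE x : phi x = normal_peak 1 * expR (- (x * x / 2)).
Proof.
rewrite /phi normal_pdfE ?oner_eq0// /normal_fun subr0 expr1n mulNr.
by rewrite -mulr_natl mulr1 expr2.
Qed.

Lemma phi_gt0 x : 0 < phi x.
Proof. by rewrite phiE mulr_gt0 ?expR_gt0 ?normal_peak_gt0 ?oner_eq0. Qed.

Lemma phiN x : phi (- x) = phi x.
Proof. by rewrite !phiE mulrNN. Qed.

Lemma normal_peak_le1 : normal_peak 1 <= 1 :> R.
Proof.
rewrite /normal_peak expr1n mul1r invf_le1; last first.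
  by rewrite sqrtr_gt0 mulrn_wgt0// pi_gt0.
rewrite -sqrtr1 ler_sqrt; last by rewrite mulrn_wge0// pi_ge0.
by have := pi_ge2 R; rewrite -mulr_natl; lra.
Qed.

Lemma phi_le1 x : phi x <= 1.
Proof.
rewrite phiE -[leRHS]mulr1 ler_pM ?normal_peak_ge0 ?expR_ge0 ?normal_peak_le1//.
by rewrite -expR0 ler_expR oppr_le0 divr_ge0// -expr2 sqr_ge0.
Qed.

Lemma has_deriv_phi : has_deriv phi (fun x => - (x * phi x)).
Proof.
have H : has_deriv (fun x => normal_peak 1 * expR (- (x * x / 2)))
    (fun x => - (x * phi x)).
  have Hq := has_derivN (has_derivM (has_derivM (@has_deriv_id R) (@has_deriv_id R))
    (has_deriv_cst 2^-1)).
  have := has_derivM (has_deriv_cst (normal_peak 1)) (has_deriv_comp (@has_deriv_expR R) Hq).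
  by move/has_deriv_eq; apply => x /=; rewrite phiE; field.
suff e : phi = (fun x => normal_peak 1 * expR (- (x * x / 2))) by rewrite -e in H.
by apply/funext => x; rewrite phiE.
Qed.

Lemma integrable_phi (D : set R) : measurable D ->
  lebesgue_measure.-integrable D (EFin \o phi).
Proof.
by move=> mD; apply: integrableS (integrable_normal_pdf 0 1).
Qed.

Lemma has_deriv_Phi : has_deriv Phi phi.
Proof.
move=> x.
have x1 : x < x + 1 by rewrite ltrDl.
have [||] := @continuous_FTC1 R phi -oo%O x (x + 1) x1
  (integrable_phi (measurable_itv _)).
- exact: ltNyr.
- exact: (has_deriv_continuous has_deriv_phi).
by move=> dF <-; rewrite derive1E; exact: derivableP.
Qed.

Let idTR : measurableTypeR R -> R := idfun.

#[local] HB.instance Definition _ :=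
  @isMeasurableFun.Build _ _ _ _ idTR (@measurable_id _ _ setT).

Let X := idTR : {RV (normal_prob (0 : R) 1) >-> R}.

Let Phi_cdf x : Phi x = fine (cdf X x).
Proof. by []. Qed.

Let fin_cdf x : cdf X x \is a fin_num.
Proof. exact: fin_num_measure. Qed.

Lemma Phi_ge0 x : 0 <= Phi x.
Proof. by rewrite Phi_cdf fine_ge0// cdf_ge0. Qed.

Lemma Phi_near0 e : 0 < e -> exists M, forall x, x <= M -> Phi x <= e.
Proof.
move=> e0; have /fine_cvgP[_ /=] := cvg_cdfNy0 X.
move=> /cvgrPdist_le/(_ _ e0)[M [_ MP]].
exists (M - 1) => x xM; have := MP x.
rewrite sub0r normrN ger0_norm ?fine_ge0 ?cdf_ge0//.
by apply; lra.
Qed.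

Lemma Phi_near1 e : 0 < e -> exists M, forall x, M <= x -> 1 - e <= Phi x.
Proof.
move=> e0; have /fine_cvgP[_ /=] := cvg_cdfy1 X.
move=> /cvgrPdist_le/(_ _ e0)[M [_ MP]].
exists (M + 1) => x xM; have := MP x.
rewrite ler_norml => /(_ _)/andP[|_]; first by lra.
by rewrite [(_ \o _) x]/= => H; rewrite Phi_cdf; lra.
Qed.

(** The function Phi x + Phi (- x) has derivative zero and tends to 1. *)
Lemma PhiN x : Phi (- x) = 1 - Phi x.
Proof.
suff H : Phi x + Phi (- x) = 1 by lra.
have HD := has_derivD has_deriv_Phi (has_deriv_opp has_deriv_Phi).
have cst y : x <= y -> Phi y + Phi (- y) = Phi x + Phi (- x).
  move=> xy; have [c _ e] := has_deriv_MVT HD xy.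
  by apply/eqP; rewrite -subr_eq0 e phiN subrr mul0r.
apply/eqP; rewrite -subr_eq0 -normr_le0; apply/ler_addgt0Pr => e e0.
have e20 : 0 < e / 2 by rewrite divr_gt0.
have [M1 H1] := Phi_near0 e20; have [M2 H2] := Phi_near1 e20.
pose y := Num.max x (Num.max (- M1) M2).
have xy : x <= y by rewrite le_max lexx.
have M2y : M2 <= y by rewrite !le_max lexx !orbT.
have M1y : - y <= M1 by rewrite lerNl !le_max lexx !orbT.
rewrite -(cst y xy) ler_norml; have := H1 _ M1y; have := H2 _ M2y.
have := Phi_ge0 (- y).
suff : Phi y <= 1 by move=> *; apply/andP; split; lra.
by rewrite Phi_cdf -[1]/(fine 1%E) fine_le// cdf_le1.
Qed.

Lemma Phi_le1 x : Phi x <= 1.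
Proof. by have := PhiN x; have := Phi_ge0 (- x); lra. Qed.

Lemma Phi_lip x y : x <= y -> Phi y <= Phi x + (y - x).
Proof.
move=> xy; have [c _ e] := has_deriv_MVT has_deriv_Phi xy.
rewrite -lerBlDl e -[leRHS]mul1r ler_wpM2r ?subr_ge0// phi_le1//.
Qed.

End NormalDistribution.

(** * The Stein equation for half-lines *)

Section SteinSolution.
Variable R : realType.
Implicit Types x y z u w : R.
Local Notation Phi := (@Phi R).
Local Notation phi := (@phi R).

(** This is the mean of the positive part of w - N for N standard normal: the
    integral of (w - y) phi y over y <= w. The same integral over y <= x, which is
    w Phi x + phi x, is nondecreasing in x <= w and at least w Phi x, which
    vanishes at -oo. *)
Lemma truncated_first_moment_ge0 w : 0 <= w * Phi w + phi w.
Proof.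
have [w0|w0] := leP 0 w.
  by rewrite addr_ge0 ?mulr_ge0 ?Phi_ge0// ltW ?phi_gt0.
have H := has_derivD (has_derivM (has_deriv_cst w) (@has_deriv_Phi R)) (@has_deriv_phi R).
rewrite -lerN2 oppr0; apply/ler_addgt0Pr => e e0; rewrite add0r.
have Nw : 0 < - w by rewrite oppr_gt0.
have [M HM] := Phi_near0 (divr_gt0 e0 Nw).
pose x := Num.min w M.
have xw : x <= w by rewrite ge_min lexx.
have xM : x <= M by rewrite ge_min lexx orbT.
have Hx : w * Phi x + phi x <= w * Phi w + phi w.
  apply: (has_deriv_le H xw) => y /andP[_ yw]; rewrite mulr0 addr0 -mulrBl.
  by rewrite mulr_ge0 ?subr_ge0// ltW ?phi_gt0.
have := HM _ xM; rewrite ler_pdivlMr// => Px.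
by have := phi_gt0 x; lra.
Qed.

(** For w < 0 this is the integral of (y - w)^2 phi y over y <= w, hence at least
    the integral over y <= 2 w, whose closed form is visibly nonnegative. *)
Lemma truncated_second_moment_ge0 w : 0 <= (1 + w ^+ 2) * Phi w + w * phi w.
Proof.
have [w0|w0] := leP 0 w.
  by rewrite addr_ge0// mulr_ge0 ?Phi_ge0 ?addr_ge0 ?sqr_ge0// ltW ?phi_gt0.
have := has_derivD (has_derivM (has_deriv_cst (1 + w ^+ 2)) (@has_deriv_Phi R))
  (has_derivM (has_derivD (has_deriv_cst (2 * w)) (has_derivN (@has_deriv_id R)))
    (@has_deriv_phi R)) => H.
have ww : 2 * w <= w by lra.
have := has_deriv_le H ww => /(_ _)/=.
rewrite subrr mul0r addr0 => le1.
have -> : (1 + w ^+ 2) * Phi w + w * phi w = (1 + w ^+ 2) * Phi w + (2 * w - w) * phi w.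
  by ring.
apply: le_trans (le1 _); first by rewrite mulr_ge0 ?Phi_ge0 ?addr_ge0 ?sqr_ge0.
move=> x _; apply: le_trans (_ : (x - w) ^+ 2 * phi x <= _).
  by rewrite mulr_ge0 ?sqr_ge0// ltW ?phi_gt0.
by rewrite le_eqVlt; apply/orP; left; apply/eqP => /=; ring.
Qed.

(** The solution of m' w = 1 + w * m w that stays bounded at -oo. *)
Definition mills w := Phi w / phi w.

Lemma has_deriv_mills : has_deriv mills (fun w => 1 + w * mills w).
Proof.
move=> x; have p0 : phi x != 0 by rewrite gt_eqF ?phi_gt0.
have h1 := is_deriveM (has_deriv_Phi x) (is_deriveV p0 (has_deriv_phi x)).
apply: is_derive_eq h1 _.
by rewrite /mills /GRing.scale/=; field.
Qed.

Lemma has_deriv_mul_mills : has_deriv (fun w => w * mills w)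
  (fun w => w * (1 + w * mills w) + mills w * 1).
Proof. exact: has_derivM (@has_deriv_id R) has_deriv_mills. Qed.

Definition kmills w := w * mills w.

Lemma kmills_mono : {homo kmills : x y / x <= y}.
Proof.
move=> x y xy; apply: (has_deriv_le has_deriv_mul_mills xy) => w _.
rewrite (_ : _ + _ = ((1 + w ^+ 2) * Phi w + w * phi w) / phi w).
  by rewrite divr_ge0 ?truncated_second_moment_ge0// ltW ?phi_gt0.
by rewrite /mills; field; rewrite gt_eqF ?phi_gt0.
Qed.

Lemma kmills_geN1 w : - 1 <= kmills w.
Proof.
rewrite -subr_ge0 opprK (_ : _ + 1 = (w * Phi w + phi w) / phi w).
  by rewrite divr_ge0 ?truncated_first_moment_ge0// ltW ?phi_gt0.
by rewrite /kmills /mills; field; rewrite gt_eqF ?phi_gt0.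
Qed.

(** On each side of z, a multiple of the solution of f' w - w * f w = const that is
    bounded on that side; the two branches agree at z. *)
Definition stein z w := if w <= z then (1 - Phi z) * mills w else Phi z * mills (- w).

Lemma stein_left z w : w <= z -> stein z w = (1 - Phi z) * mills w.
Proof. by rewrite /stein => ->. Qed.

Lemma stein_right z w : z <= w -> stein z w = Phi z * mills (- w).
Proof.
rewrite le_eqVlt => /predU1P[<-|zw]; last by rewrite /stein leNgt zw.
by rewrite /stein lexx /mills PhiN phiN mulrCA mulrA.
Qed.

Definition gstein z w := w * stein z w.

Lemma gstein_left z w : w <= z -> gstein z w = (1 - Phi z) * kmills w.
Proof. by move=> wz; rewrite /gstein stein_left// mulrCA. Qed.

Lemma gstein_right z w : z <= w -> gstein z w = - (Phi z * kmills (- w)).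
Proof. by move=> wz; rewrite /gstein stein_right// /kmills; ring. Qed.

Let Phi1 z : 0 <= 1 - Phi z. Proof. by rewrite subr_ge0 Phi_le1. Qed.

Lemma gstein_mono z : {homo gstein z : x y / x <= y}.
Proof.
have L x y : x <= y -> y <= z -> gstein z x <= gstein z y.
  by move=> xy yz; rewrite !gstein_left ?(le_trans xy)// ler_wpM2l ?kmills_mono.
have U x y : x <= y -> z <= x -> gstein z x <= gstein z y.
  move=> xy zx; rewrite !gstein_right ?(le_trans zx)// lerN2 ler_wpM2l ?Phi_ge0//.
  by rewrite kmills_mono// lerN2.
move=> x y xy; have [yz|/ltW zy] := leP y z; first exact: L.
have [xz|/ltW zx] := leP x z; last exact: U.
exact: le_trans (L _ _ xz (lexx _)) (U _ _ zy (lexx _)).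
Qed.

Lemma gstein_bounds z w : - (1 - Phi z) <= gstein z w <= Phi z.
Proof.
have k x : - 1 <= kmills x := kmills_geN1 x.
have lo x : x <= z -> - (1 - Phi z) <= gstein z x.
  by move=> xz; rewrite gstein_left// -mulrN1 ler_wpM2l.
have hi x : z <= x -> gstein z x <= Phi z.
  move=> zx; rewrite gstein_right// -mulrN -[leRHS]mulr1 ler_wpM2l ?Phi_ge0//.
  by rewrite lerNl.
have [wz|/ltW zw] := leP w z; apply/andP; split.
- exact: lo.
- exact: le_trans (gstein_mono z wz) (hi _ (lexx _)).
- exact: le_trans (lo _ (lexx _)) (gstein_mono z zw).
- exact: hi.
Qed.

Lemma gstein_le1 z w : `|gstein z w| <= 1.
Proof.
have /andP[] := gstein_bounds z w; have := Phi_ge0 z; have := Phi1 z.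
by rewrite ler_norml => *; apply/andP; split; lra.
Qed.

Lemma dstein_le1 z w : `|gstein z w + (w <= z)%R%:R - Phi z| <= 1.
Proof.
have /andP[] := gstein_bounds z w; have := Phi_ge0 z; have := Phi1 z.
move=> h1 h2 h3 h4; rewrite ler_norml; case: (leP w z) => _ /=.
all: by apply/andP; split; lra.
Qed.

(** The mean value theorem on each side of z, with [gstein_mono] to bound the
    derivative at the intermediate points. *)
Lemma stein_increment z (a b : R) : a <= b ->
  (b - a) * (gstein z a + (b <= z)%R%:R - Phi z) <= stein z b - stein z a <=
  (b - a) * (gstein z b + (a <= z)%R%:R - Phi z).
Proof.
have L x y : x <= y -> y <= z ->
    exists2 c, x <= c <= y & stein z y - stein z x = (y - x) * (gstein z c + 1 - Phi z).
  move=> xy yz; have [c cxy e] := has_deriv_MVT has_deriv_mills xy.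
  exists c => //; rewrite !stein_left ?(le_trans xy)// -mulrBr e gstein_left.
    by rewrite /kmills; ring.
  by case/andP: cxy => _ /le_trans; apply.
have U x y : x <= y -> z <= x ->
    exists2 c, x <= c <= y & stein z y - stein z x = (y - x) * (gstein z c - Phi z).
  move=> xy zx; have [c cxy e] := has_deriv_MVT (has_deriv_opp has_deriv_mills) xy.
  exists c => //; rewrite !stein_right ?(le_trans zx)// -mulrBr e gstein_right.
    by rewrite /kmills; ring.
  by case/andP: cxy => xc _; apply: le_trans zx xc.
move=> ab; have ba0 : 0 <= b - a by rewrite subr_ge0.
have [bz|zb] := leP b z.
  rewrite (le_trans ab bz); have [c /andP[ac cb] ->] := L _ _ ab bz.
  by rewrite !ler_wpM2l// !lerD2r gstein_mono.
have [az|za] := leP a z.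
  have [c /andP[ac cz] e1] := L _ _ az (lexx _).
  have [c' /andP[zc' cb'] e2] := U _ _ (ltW zb) (lexx _).
  have -> : stein z b - stein z a = (z - a) * (gstein z c + 1 - Phi z) +
    (b - z) * (gstein z c' - Phi z) by rewrite -e1 -e2; ring.
  have -> : b - a = (z - a) + (b - z) by ring.
  have za0 : 0 <= z - a by rewrite subr_ge0.
  have bz0 : 0 <= b - z by rewrite subr_ge0 ltW.
  move: (z - a) (b - z) za0 bz0 => d1 d2 d10 d20.
  rewrite !mulrDl; apply/andP; split; apply: lerD; apply: ler_wpM2l => //=.
  - by have := gstein_mono z ac; lra.
  - have := gstein_mono z (le_trans ac (le_trans cz zc')); lra.
  - have := gstein_mono z (le_trans cz (ltW zb)); lra.
  - have := gstein_mono z cb'; lra.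
have [c /andP[ac cb] ->] := U _ _ ab (ltW za).
rewrite /= !addr0 !ler_wpM2l// !lerD2r gstein_mono//.
Qed.

Lemma expRN_le x : 0 <= x -> expR (- x) <= (1 + x)^-1.
Proof.
move=> x0; rewrite expRN lef_pV2 ?posrE ?expR_gt0 ?expR_ge1Dx//.
by rewrite ltr_wpDr.
Qed.

Lemma normal_tail_le z : 0 <= z -> 1 - Phi z <= 4 / (1 + z) ^+ 2.
Proof.
move=> z0; have p : 0 < (1 + z) ^+ 2 by rewrite exprn_gt0// ltr_wpDr.
rewrite ler_pdivlMr//.
have [z1|z1] := leP z 1.
  have P1 : 1 - Phi z <= 1 by have := Phi_ge0 z; lra.
  apply: le_trans (_ : 1 * (1 + z) ^+ 2 <= _); first by rewrite ler_wpM2r ?sqr_ge0.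
  by rewrite mul1r; nra.
have := truncated_first_moment_ge0 (- z); rewrite phiN PhiN => h.
have phile : phi z <= (1 + z * z / 2)^-1.
  rewrite phiE; apply: le_trans (expRN_le _); last by rewrite divr_ge0// mulr_ge0.
  by rewrite ler_piMl ?expR_ge0// normal_peak_le1.
have h2 : 1 - Phi z <= (1 + z * z / 2)^-1.
  apply: le_trans phile; apply: le_trans (_ : z * (1 - Phi z) <= _); last by lra.
  by rewrite ler_peMl// ltW.
apply: le_trans (_ : (1 + z * z / 2)^-1 * (1 + z) ^+ 2 <= _).
  by rewrite ler_wpM2r ?sqr_ge0.
by rewrite mulrC ler_pdivrMr; nra.
Qed.

(** The upper bound holds since z (1 - Phi z) <= phi z and
    phi z / phi (z / 2) = exp (- 3 z^2 / 8). *)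
Lemma kmills_tail_le z u : 0 <= z -> `|u| <= z / 2 ->
  `|(1 - Phi z) * kmills u| <= 6 / (1 + z) ^+ 2.
Proof.
move=> z0 uz.
have p : 0 < (1 + z) ^+ 2 by rewrite exprn_gt0// ltr_wpDr.
have lo : - (1 - Phi z) <= (1 - Phi z) * kmills u.
  by rewrite -mulrN1 ler_wpM2l// kmills_geN1.
have t := normal_tail_le z0.
have t' : 4 / (1 + z) ^+ 2 <= 6 / (1 + z) ^+ 2 by rewrite ler_wpM2r ?invr_ge0 ?ltW//; lra.
rewrite ler_norml; apply/andP; split; first by lra.
have uz' : u <= z / 2 by apply: le_trans uz; rewrite ler_norm.
apply: le_trans (ler_wpM2l (Phi1 z) (kmills_mono uz')) _.
have h := truncated_first_moment_ge0 (- z); rewrite phiN PhiN in h.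
have {}h : z * (1 - Phi z) <= phi z by lra.
have p2 := phi_gt0 (z / 2).
have -> : (1 - Phi z) * kmills (z / 2) =
    (z * (1 - Phi z)) * (Phi (z / 2) * ((phi (z / 2))^-1 / 2)).
  by rewrite /kmills /mills; field; rewrite gt_eqF.
apply: (@le_trans _ _ (phi z * (1 * ((phi (z / 2))^-1 / 2)))).
  have p20 : 0 <= (phi (z / 2))^-1 / 2 by rewrite divr_ge0 ?invr_ge0// ltW.
  apply: ler_pM => //; [exact: mulr_ge0|by rewrite mulr_ge0 ?Phi_ge0|].
  by rewrite ler_wpM2r ?Phi_le1.
have pz : phi z = phi (z / 2) * expR (- (3 * (z * z) / 8)).
  by rewrite !phiE -[RHS]mulrA -expRD; congr (_ * expR _); field.
have -> : phi z * (1 * ((phi (z / 2))^-1 / 2)) = expR (- (3 * (z * z) / 8)) / 2.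
  by rewrite pz; field; rewrite gt_eqF.
have zz : 0 <= 3 * (z * z) / 8 by rewrite divr_ge0// !mulr_ge0.
apply: le_trans (ler_wpM2r _ (expRN_le zz)) _; first by rewrite invr_ge0.
rewrite ler_pdivlMr// -[leLHS]mulrA [leLHS]mulrC ler_pdivrMr; last by rewrite ltr_wpDr.
by nra.
Qed.

Lemma gstein_small z u : `|u| <= `|z| / 2 -> `|gstein z u| <= 10 / (1 + `|z|) ^+ 2.
Proof.
have p : 0 < (1 + `|z|) ^+ 2 by rewrite exprn_gt0// ltr_wpDr.
have t' : 6 / (1 + `|z|) ^+ 2 <= 10 / (1 + `|z|) ^+ 2.
  by rewrite ler_wpM2r ?invr_ge0 ?ltW//; lra.
move=> uz; apply: le_trans t'.
have [z0|z0] := leP 0 z.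
  rewrite (ger0_norm z0) in uz *; rewrite gstein_left; last first.
    by have := ler_norm u; lra.
  exact: kmills_tail_le.
rewrite (ltr0_norm z0) in uz *; rewrite gstein_right; last first.
  by have := ler_norm (- u); rewrite normrN; lra.
rewrite normrN (_ : Phi z = 1 - Phi (- z)); last by rewrite PhiN; ring.
by apply: kmills_tail_le; [rewrite oppr_ge0 ltW|rewrite normrN].
Qed.

Lemma dstein_small z u : `|u| <= `|z| / 2 ->
  `|gstein z u + (u <= z)%R%:R - Phi z| <= 10 / (1 + `|z|) ^+ 2.
Proof.
move=> uz.
have e10 : 10 / (1 + `|z|) ^+ 2 = 6 / (1 + `|z|) ^+ 2 + 4 / (1 + `|z|) ^+ 2.
  by rewrite -mulrDl; congr (_ / _); ring.
have [z0|z0] := leP 0 z.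
  have uz' : u <= z by have := ler_norm u; rewrite (ger0_norm z0) in uz; lra.
  rewrite uz' gstein_left// -addrA e10 (ger0_norm z0) in uz *.
  apply: le_trans (ler_normD _ _) _; rewrite lerD ?kmills_tail_le//.
  by rewrite ger0_norm ?normal_tail_le// subr_ge0 Phi_le1.
have zu : z < u by have := ler_norm (- u); rewrite normrN; rewrite (ltr0_norm z0) in uz; lra.
rewrite (leNgt u z) zu /= addr0 (gstein_right (ltW zu)) e10 (ltr0_norm z0) in uz *.
have -> : Phi z = 1 - Phi (- z) by rewrite PhiN; ring.
apply: le_trans (ler_normB _ _) _; rewrite normrN lerD//.
  by apply: kmills_tail_le; [rewrite oppr_ge0 ltW|rewrite normrN].
rewrite ger0_norm ?normal_tail_le// ?oppr_ge0 ?(ltW z0)//.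
Qed.

End SteinSolution.

(** * Finite-valued functions of the variables *)

Definition finite_valued (R : realType) (g : R -> R) :=
  exists s : seq R, forall x, g x \in s.

Lemma measurable_seq_sub (R : realType) (g : R -> R) (s : seq R)
    (gs : forall x, g x \in s) (a : seq_sub s) :
  measurable_fun [set: R] g -> measurable ((fun x => SeqSub (gs x)) @^-1` [set a]).
Proof.
move=> mg; rewrite (_ : _ @^-1` _ = g @^-1` [set ssval a]); last first.
  by apply/seteqP; split=> x /= e; [rewrite -e|exact: val_inj].
by rewrite -[X in measurable X]setTI; exact: mg.
Qed.

Section FiniteCode.
Context (d : measure_display) (T : measurableType d) (R : realType)
  (P : probability T R).

Lemma expectation_finite (F : finType) (c : T -> F) (h : F -> R) :
  (forall a, measurable (c @^-1` [set a])) ->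
  ('E_P[fun t => h (c t)] = (\sum_a h a * fine (P (c @^-1` [set a])))%:E)%E.
Proof.
move=> mc; rewrite unlock.
have e t : (h (c t))%:E = (\sum_a (h a)%:E * (\1_(c @^-1` [set a]) t)%:E)%E.
  rewrite (bigD1 (c t))//= indicE mem_set// mule1 big1 ?adde0// => a ac.
  by rewrite indicE memNset ?mule0// => /= e; rewrite e eqxx in ac.
under eq_integral do rewrite e.
have mi a : P.-integrable setT (fun t => (\1_(c @^-1` [set a]) t)%:E).
  exact: integrable_indic.
rewrite integral_sum//; last by move=> a; exact: integrableZl.
rewrite -sumEFin; apply: eq_bigr => a _.
by rewrite integralZl// integral_indic// setIT EFinM fineK// fin_num_measure.
Qed.

Lemma probability_finite (F : finType) (c : T -> F) (Q : pred F) :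
  (forall a, measurable (c @^-1` [set a])) ->
  fine (P [set t | Q (c t)]) = \sum_a (Q a)%:R * fine (P (c @^-1` [set a])).
Proof.
move=> mc; rewrite -[RHS]/(fine (_%:E)) -(@expectation_finite _ c (fun a => (Q a)%:R))//.
have mQ : measurable [set t | Q (c t)].
  rewrite (_ : [set _ | _] = \bigcup_(a in [set` Q]) c @^-1` [set a]).
    by apply: fin_bigcup_measurable => //; exact: finite_finset.
  by apply/seteqP; split=> t /=; [exists (c t)|move=> [a /= Qa] /= ->].
rewrite -(expectation_indic _ mQ); congr (fine _); congr (expectation _ _).
apply/funext => t; rewrite indicE; congr (_%:R); congr nat_of_bool.
by apply/idP/idP; rewrite inE.
Qed.

Variables (n : nat) (X : 'I_n.+1 -> {RV P >-> R}).
Hypothesis X_iid : iid X.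
Variables (F : finType) (c : R -> F).
Hypothesis mc : forall a, measurable (c @^-1` [set a]).

Definition pushmass (a : F) : R := fine (P ((c \o X ord0) @^-1` [set a])).

Definition codes (t : T) : {ffun 'I_n.+1 -> F} := [ffun i => c (X i t)].

Lemma measurable_code i a : measurable ((c \o X i) @^-1` [set a]).
Proof. by rewrite comp_preimage; exact: measurable_funPTI. Qed.

Lemma codes_preimage w : codes @^-1` [set w] =
  \bigcap_(i in [set i | i \in [set: 'I_n.+1]%SET]) (X i @^-1` (c @^-1` [set (w i)])).
Proof.
apply/seteqP; split=> t /=.
  by move=> <- i _ /=; rewrite ffunE.
by move=> H; apply/ffunP => i; rewrite ffunE; apply: H => /=; rewrite finset.in_setT.
Qed.

Lemma measurable_codes w : measurable (codes @^-1` [set w]).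
Proof.
rewrite codes_preimage; apply: fin_bigcap_measurable => [|i _].
  exact: finite_finset.
exact: measurable_code.
Qed.

Lemma pushmassE i a : P ((c \o X i) @^-1` [set a]) = (pushmass a)%:E.
Proof.
rewrite /pushmass fineK; last exact/fin_num_measure/measurable_code.
have := X_iid.2 i ord0 _ (mc a); rewrite /distribution /pushforward => H.
exact: H.
Qed.

(** Independence and equality in law are used only through this product formula
    for the joint law of the codes. *)
Lemma codes_mass w : fine (P (codes @^-1` [set w])) = mass pushmass w.
Proof.
rewrite codes_preimage X_iid.1 => [|i]; last exact: mc.
rewrite (eq_bigr (fun i => (pushmass (w i))%:E)) => [|i _].
  by rewrite prodEFin; apply: eq_bigl => i; rewrite finset.in_setT.
by rewrite -(pushmassE i) comp_preimage.
Qed.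

Lemma pushmass_ge0 a : 0 <= pushmass a.
Proof. by rewrite fine_ge0. Qed.

Lemma expectation_code (h : F -> R) :
  ('E_P[fun t => h (c (X ord0 t))] = (mean1 pushmass h)%:E)%E.
Proof.
rewrite (@expectation_finite _ (c \o X ord0))//; last exact: measurable_code.
by congr (_%:E); apply: eq_bigr => a _; rewrite mulrC.
Qed.

Lemma pushmass_sum1 : \sum_a pushmass a = 1.
Proof.
have := expectation_code (fun=> 1); rewrite (_ : (fun _ => _) = cst 1)//.
rewrite expectation_cst => -[] ->; apply: eq_bigr => a _; by rewrite mulr1.
Qed.

Lemma probability_codes (Q : pred {ffun 'I_n.+1 -> F}) :
  fine (P [set t | Q (codes t)]) = mean pushmass (fun w => (Q w)%:R).
Proof.
rewrite (probability_finite _ measurable_codes).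
by apply: eq_bigr => w _; rewrite codes_mass mulrC.
Qed.

End FiniteCode.

(** The rate in the theorem, without the factors that depend on z and on the
    fourth moment. *)
Definition fluctuation (R : realType) (n : nat) (A : 'M[R]_n) : R :=
  (Num.sqrt (\sum_i (\sum_j A i j ^+ 2) ^+ 2) +
   Num.sqrt (\sum_i \sum_j (\sum_k A i k * A j k) ^+ 2)) / sigma2 A.

Section SimpleCase.
Context (d : measure_display) (T : measurableType d) (R : realType)
  (P : probability T R) (n : nat) (X : 'I_n.+1 -> {RV P >-> R})
  (A : 'M[R]_n.+1).
Hypothesis X_iid : iid X.
Hypothesis A_sym : A^T = A.
Hypothesis A_diag : forall i, A i i = 0.
Hypothesis sA : 0 < sigma2 A.

Let b (i j : 'I_n.+1) := (Num.sqrt (sigma2 A))^-1 * A i j.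

Let s_gt0 : 0 < Num.sqrt (sigma2 A). Proof. by rewrite sqrtr_gt0. Qed.

Let s_sqr : Num.sqrt (sigma2 A) ^+ 2 = sigma2 A. Proof. by rewrite sqr_sqrtr// ltW. Qed.

Let b_sym i j : b i j = b j i.
Proof. by rewrite /b -[in A i j]A_sym mxE. Qed.
Let b_diag i : b i i = 0. Proof. by rewrite /b A_diag mulr0. Qed.

Let row_sqr i : \sum_j b i j ^+ 2 = (sigma2 A)^-1 * \sum_j A i j ^+ 2.
Proof.
rewrite mulr_sumr; apply: eq_bigr => j _.
by rewrite exprMn exprVn s_sqr.
Qed.

Let b_norm : 2 * \sum_i \sum_j b i j ^+ 2 = 1.
Proof.
under eq_bigr do rewrite row_sqr.
by rewrite -mulr_sumr mulrCA -/(sigma2 A) mulVf// gt_eqF.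
Qed.

Lemma spread_fluctuation : spread b <= fluctuation A ^+ 2.
Proof.
have S1 : \sum_i (\sum_j b i j ^+ 2) ^+ 2 =
    (sigma2 A) ^- 2 * \sum_i (\sum_j A i j ^+ 2) ^+ 2.
  by rewrite mulr_sumr; apply: eq_bigr => i _; rewrite row_sqr exprMn exprVn.
have S2 : \sum_i \sum_j gram b i j ^+ 2 =
    (sigma2 A) ^- 2 * \sum_i \sum_j (\sum_k A i k * A j k) ^+ 2.
  rewrite mulr_sumr; apply: eq_bigr => i _; rewrite mulr_sumr.
  apply: eq_bigr => j _; rewrite -exprVn -exprMn; congr (_ ^+ 2).
  rewrite mulr_sumr; apply: eq_bigr => k _.
  by rewrite /b -[in RHS]s_sqr; field; rewrite gt_eqF.
rewrite /spread S1 S2 -mulrDr /fluctuation expr_div_n mulrC ler_wpM2r//.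
  by rewrite invr_ge0 sqr_ge0.
rewrite sqrrD !sqr_sqrtr; last 2 first.
- by apply: sumr_ge0 => i _; apply: sumr_ge0 => j _; rewrite sqr_ge0.
- by apply: sumr_ge0 => i _; rewrite sqr_ge0.
by rewrite [leRHS]addrAC lerDl mulrn_wge0// mulr_ge0.
Qed.

Lemma fluctuation_gt0 : 0 < fluctuation A.
Proof.
rewrite divr_gt0// ltr_pwDl ?sqrtr_ge0// sqrtr_gt0 lt_neqAle eq_sym.
have nn i : true -> 0 <= (\sum_j A i j ^+ 2) ^+ 2 by move=> _; rewrite sqr_ge0.
rewrite sumr_ge0// andbT; apply: contraTneq sA => s0.
rewrite /sigma2 big1 ?mulr0 ?ltxx// => i _; apply/eqP; rewrite -sqrf_eq0.
by rewrite (psumr_eq0P nn s0).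
Qed.

Lemma W_quad (F : finType) (c : R -> F) (v : F -> R) t :
  W A (fun i t => v (c (X i t))) t = quad v b (codes X c t).
Proof.
rewrite /W /quad mulr_sumr; apply: eq_bigr => i _.
rewrite mulr_sumr [RHS](bigD1 i)//= b_diag !mul0r add0r.
apply: eq_big => [j|j _]; first by rewrite eq_sym.
by rewrite !ffunE /b -!mulrA.
Qed.

Lemma finite_valued_bound (g : R -> R) (z : R) :
  measurable_fun [set: R] g -> finite_valued g ->
  ('E_P[fun t => g (X ord0 t)] = 0)%E ->
  ('E_P[fun t => (g (X ord0 t) ^+ 2)%R] = 1)%E ->
  `|fine (P [set t | W A (fun i t => g (X i t)) t <= z]) - Phi z| <=
  10 ^+ 6 * fine ('E_P[fun t => (g (X ord0 t) ^+ 4)%R])%E ^+ 2 * fluctuation A /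
    (1 + `|z|) ^+ 2.
Proof.
move=> mg [s gs] g1 g2.
pose c x : seq_sub s := SeqSub (gs x).
have mc a : measurable (c @^-1` [set a]) by exact: measurable_seq_sub.
have E1 (h : seq_sub s -> R) := expectation_code X mc h.
pose v (a : seq_sub s) := ssval a.
have gE (f : R -> R) : (fun t => f (g (X ord0 t))) = fun t => f (v (c (X ord0 t))) by [].
have v1 : mean1 (pushmass X c) v = 0.
  by have := E1 v; rewrite -[fun t => _]/(fun t => g (X ord0 t)) g1 => -[].
have v2 : mean1 (pushmass X c) (fun a => v a ^+ 2) = 1.
  by have := E1 (fun a => v a ^+ 2); rewrite -(gE (fun y => y ^+ 2)) g2 => -[].
have -> : fine ('E_P[fun t => (g (X ord0 t) ^+ 4)%R])%E =
    mean1 (pushmass X c) (fun a => v a ^+ 4).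
  by rewrite (gE (fun y => y ^+ 4)) (E1 (fun a => v a ^+ 4)).
have -> : fine (P [set t | W A (fun i t => g (X i t)) t <= z]) =
    mean (pushmass X c) (fun w => (quad v b w <= z)%R%:R).
  rewrite -(probability_codes X_iid mc); congr (fine (P _)).
  by apply/seteqP; split=> t /=; rewrite -W_quad.
have := quad_nonuniform_bound (pushmass_ge0 X c) (pushmass_sum1 X mc) v1 v2
  b_sym b_diag b_norm (f := stein z) (g := gstein z) (fun u => erefl (gstein z u)) (@gstein_mono R z)
  (@stein_increment R z) (gstein_le1 z) (dstein_le1 z) (@gstein_small R z)
  (@dstein_small R z) fluctuation_gt0 spread_fluctuation.
by [].
Qed.

End SimpleCase.

(** * Finite-valued approximations *)

(** The bound |g k x| <= |x| keeps all moments below those of the variable, and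
    serves as domination in the convergence of the first two. *)
Lemma id_approximation (R : realType) : exists g : nat -> R -> R,
  [/\ forall k, measurable_fun setT (g k), forall k, finite_valued (g k),
      forall k x, `|g k x| <= `|x| & forall x, g ^~ x @ \oo --> x].
Proof.
have mid : measurable_fun [set: R] (@idfun R) by exact: measurable_id.
have mp : measurable_fun [set: R] (fun x => ((@idfun R)^\+ x)%:E).
  by apply/measurable_EFinP; exact: measurable_funrpos.
have mn : measurable_fun [set: R] (fun x => ((@idfun R)^\- x)%:E).
  by apply/measurable_EFinP; exact: measurable_funrneg.
pose hp := nnsfun_approx measurableT mp; pose hn := nnsfun_approx measurableT mn.
have p0 (x : R) : setT x -> (0 <= ((@idfun R)^\+ x)%:E)%E.
  by move=> _; rewrite lee_fin funrpos_ge0.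
have n0 (x : R) : setT x -> (0 <= ((@idfun R)^\- x)%:E)%E.
  by move=> _; rewrite lee_fin funrneg_ge0.
have fin (h : {nnsfun R >-> R}) : finite_valued h.
  have [s hs] : exists s : seq R, range (h : R -> R) = [set` s].
    by apply/finite_seqP; exact: fimfunP.
  exists s => x; suff : [set` s] (h x) by [].
  by rewrite -hs; exists x.
have hple k x : hp k x <= (@idfun R)^\+ x.
  by rewrite -lee_fin /hp nnsfun_approxE; exact: le_approx.
have hnle k x : hn k x <= (@idfun R)^\- x.
  by rewrite -lee_fin /hn nnsfun_approxE; exact: le_approx.
have hp0 k x : 0 <= hp k x by [].
have hn0 k x : 0 <= hn k x by [].
exists (fun k x => hp k x - hn k x); split.
- by move=> k; apply: measurable_funB.
- move=> k; have [sp Hp] := fin (hp k); have [sn Hn] := fin (hn k).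
  by exists [seq a - b | a <- sp, b <- sn] => x; apply: allpairs_f.
- move=> k x; have := hple k x; have := hnle k x; have := hp0 k x; have := hn0 k x.
  rewrite /funrpos /funrneg /= => a0 b0.
  have [x0|x0] := leP 0 x.
    rewrite (_ : Num.max (- x) 0 = 0); last by apply/max_idPr; rewrite oppr_le0.
    by move=> an bp; rewrite (ger0_norm x0) ler_norml; apply/andP; split; lra.
  rewrite (_ : Num.max (- x) 0 = - x); last by apply/max_idPl; rewrite oppr_ge0 ltW.
  by move=> an bp; rewrite (ltr0_norm x0) ler_norml; apply/andP; split; lra.
- move=> x; have e : x = (@idfun R)^\+ x - (@idfun R)^\- x.
    exact: (esym (congr1 (fun h : R -> R => h x) (funrposBneg (@idfun R)))).
  rewrite [X in _ --> X]e; apply: cvgB.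
    have /fine_cvgP[_] := cvg_nnsfun_approx measurableT mp p0 (I : setT x).
    exact.
  have /fine_cvgP[_] := cvg_nnsfun_approx measurableT mn n0 (I : setT x).
  exact.
Qed.

Section StandardisedSimple.
Context (d : measure_display) (T : measurableType d) (R : realType)
  (P : probability T R) (n : nat) (X : 'I_n.+1 -> {RV P >-> R})
  (A : 'M[R]_n.+1).
Hypothesis X_iid : iid X.
Hypothesis A_sym : A^T = A.
Hypothesis A_diag : forall i, A i i = 0.
Hypothesis sA : 0 < sigma2 A.
Variable g : R -> R.
Hypothesis mg : measurable_fun [set: R] g.
Hypothesis fg : finite_valued g.

Lemma finite_valued_law : exists (F : finType) (p v : F -> R),
  [/\ forall a, 0 <= p a, \sum_a p a = 1 & forall f : R -> R,
    ('E_P[fun t => f (g (X ord0 t))] = (mean1 p (fun a => f (v a)))%:E)%E].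
Proof.
have [s gs] := fg; pose c x : seq_sub s := SeqSub (gs x).
have mc a : measurable (c @^-1` [set a]) by exact: measurable_seq_sub.
exists (seq_sub s : finType), (pushmass X c), (fun a => ssval a); split.
- exact: pushmass_ge0.
- exact: pushmass_sum1.
- by move=> f; rewrite -(expectation_code X mc).
Qed.

(** Standardising costs a factor in the fourth moment:
    (x - mu)^4 <= 8 (x^4 + mu^4) and var^2 >= 1/4 lead to 32 (m4 + 1) <= 64 m4. *)
Lemma standardised_bound (mu var m4 z : R) :
  ('E_P[fun t => g (X ord0 t)] = mu%:E)%E ->
  ('E_P[fun t => (g (X ord0 t) ^+ 2)%R] = (var + mu ^+ 2)%:E)%E ->
  ('E_P[fun t => (g (X ord0 t) ^+ 4)%R] <= m4%:E)%E ->
  1 <= m4 -> `|mu| <= 1 -> 2^-1 <= var ->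
  `|fine (P [set t | W A (fun i t => (g (X i t) - mu) / Num.sqrt var) t <= z])
    - Phi z| <=
  10 ^+ 6 * (64 * m4) ^+ 2 * fluctuation A / (1 + `|z|) ^+ 2.
Proof.
move=> e1 e2 e4 m41 mu1 var2.
have v0 : 0 < var by lra.
have s0 : 0 < Num.sqrt var by rewrite sqrtr_gt0.
have s2 : Num.sqrt var ^+ 2 = var by rewrite sqr_sqrtr// ltW.
have [F [p [v [p0 p1 law]]]] := finite_valued_law.
have l1 : mean1 p v = mu by move: (law id); rewrite e1 => -[].
have l2 : mean1 p (fun a => v a ^+ 2) = var + mu ^+ 2.
  by move: (law (fun y => y ^+ 2)); rewrite e2 => -[].
have l4 : mean1 p (fun a => v a ^+ 4) <= m4.
  by move: (law (fun y => y ^+ 4)) e4 => ->; rewrite lee_fin.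
pose h y := (y - mu) / Num.sqrt var.
have h1 : mean1 p (fun a => h (v a)) = 0.
  rewrite (_ : mean1 p _ = mean1 p (fun a => (Num.sqrt var)^-1 * (v a - mu))).
    by rewrite mean1Z mean1B l1 mean1_cst// subrr mulr0.
  by apply: eq_mean1 => a; rewrite /h mulrC.
have h2 : mean1 p (fun a => h (v a) ^+ 2) = 1.
  rewrite (_ : mean1 p _ = mean1 p (fun a => var^-1 *
    (v a ^+ 2 + ((- 2 * mu) * v a + mu ^+ 2)))).
    by rewrite mean1Z !mean1D mean1Z mean1_cst// l1 l2; field; rewrite gt_eqF.
  by apply: eq_mean1 => a; rewrite /h expr_div_n s2; field; rewrite gt_eqF.
have h4 : mean1 p (fun a => h (v a) ^+ 4) <= 64 * m4.
  apply: (@le_trans _ _ (mean1 p (fun a => 32 * (v a ^+ 4 + 1)))).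
    apply: le_mean1 => // a; rewrite /h expr_div_n (exprM (Num.sqrt var) 2 2) s2.
    set x := v a; rewrite ler_pdivrMr ?exprn_gt0//.
    have c1 : (x - mu) ^+ 4 <= 8 * (x ^+ 4 + mu ^+ 4).
      rewrite -subr_ge0 (_ : _ - _ = (x + mu) ^+ 2 *
        ((x + mu) ^+ 2 + 6 * (x - mu) ^+ 2)); last by ring.
      by do ?[exact: sqr_ge0 | exact: ler0n | apply: mulr_ge0 | apply: addr_ge0].
    have c2 : mu ^+ 4 <= 1.
      by rewrite (exprM mu 2 2) -(real_normK (num_real mu)) -exprM exprn_ile1.
    have c3 : 4^-1 <= var ^+ 2 by nra.
    have c4 : 0 <= x ^+ 4 by rewrite (exprM x 2 2) sqr_ge0.
    have : 32 * (x ^+ 4 + 1) * 4^-1 <= 32 * (x ^+ 4 + 1) * var ^+ 2.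
      by rewrite ler_wpM2l// mulr_ge0// addr_ge0.
    by lra.
  by rewrite mean1Z mean1D mean1_cst//; lra.
have gh f : ('E_P[fun t => f (h (g (X ord0 t)))] = (mean1 p (fun a => f (h (v a))))%:E)%E.
  exact: (law (fun y => f (h y))).
have mh : measurable_fun [set: R] (fun x => h (g x)).
  by apply: measurable_funM => //; apply: measurable_funB.
have fh : finite_valued (fun x => h (g x)).
  by have [s gs] := fg; exists (map h s) => x; apply: map_f.
have := finite_valued_bound X_iid A_sym A_diag sA z mh fh.
rewrite (gh id) (gh (fun y => y ^+ 2)) (gh (fun y => y ^+ 4)) h1 h2.
move=> /(_ erefl erefl)/le_trans; apply.
have f0 := fluctuation_gt0 sA.
rewrite ler_wpM2r ?invr_ge0 ?exprn_ge0 ?addr_ge0//.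
apply: (ler_wpM2r (ltW f0)).
rewrite ler_pM2l ?exprn_gt0// ler_sqr ?nnegrE//=.
  by apply: mean1_ge0 => // a; rewrite (exprM _ 2 2) sqr_ge0.
by lra.
Qed.

End StandardisedSimple.

(** * Passage to the limit *)

Section Limits.
Context (d : measure_display) (T : measurableType d) (R : realType)
  (P : probability T R).

(** Fatou's lemma for events: S is contained in the increasing union of the
    intersections of the S_ j over j >= k. *)
Lemma probability_liminf_le (S : set T) (S_ : nat -> set T) (c : R) (k0 : nat) :
  measurable S -> (forall k, measurable (S_ k)) ->
  (forall t, S t -> exists N, forall k, (N <= k)%N -> S_ k t) ->
  (forall k, (k0 <= k)%N -> fine (P (S_ k)) <= c) -> fine (P S) <= c.
Proof.
move=> mS mS_ ev le; pose F k := \bigcap_(j in [set j | (k <= j)%N]) S_ j.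
have mF k : measurable (F k) by apply: bigcap_measurable => //; exists k => /=.
have cF : (P \o F) k @[k --> \oo] --> P (\bigcup_k F k).
  apply: nondecreasing_cvg_mu => //; first exact: bigcup_measurable.
  move=> i j ij; apply/subsetPset => t Ft k /= jk; apply: Ft => /=.
  exact: leq_trans ij jk.
have SF : S `<=` \bigcup_k F k by move=> t /ev[N HN]; exists N => // k /= /HN.
rewrite -lee_fin fineK ?fin_num_measure//.
apply: (@le_trans _ _ (P (\bigcup_k F k))).
  by rewrite le_measure ?inE//; exact: bigcup_measurable.
apply: cvge_le cF; exists k0 => //= k /= kk0.
apply: (@le_trans _ _ (P (S_ k))); first by rewrite le_measure ?inE// => t; apply; exact: leqnn.
by rewrite -[P (S_ k)]fineK ?fin_num_measure// lee_fin le.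
Qed.

Lemma measurable_W (n : nat) (A : 'M[R]_n) (Z : 'I_n -> T -> R) :
  (forall i, measurable_fun [set: T] (Z i)) -> measurable_fun [set: T] (W A Z).
Proof.
move=> mZ; apply: measurable_funM => //; apply: measurable_sum => i.
under eq_fun do rewrite big_mkcond.
apply: measurable_sum => j; case: (i != j) => //.
by apply: measurable_funM => //; apply: measurable_funM.
Qed.

Lemma W_cvg (n : nat) (A : 'M[R]_n) (Z : 'I_n -> T -> R) (Zk : nat -> 'I_n -> T -> R) t :
  (forall i, Zk k i t @[k --> \oo] --> Z i t) ->
  W A (Zk k) t @[k --> \oo] --> W A Z t.
Proof.
move=> cZ; apply: cvgMl_tmp; apply: cvg_big => [|i _]; first exact: add_continuous.
apply: cvg_big => [|j _]; first exact: add_continuous.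
by apply: cvgM => //; apply: cvgMl_tmp.
Qed.

End Limits.

Section MomentConvergence.
Context (d : measure_display) (T : measurableType d) (R : realType)
  (P : probability T R) (Y : {RV P >-> R}).
Hypothesis Y4 : ('E_P[fun t => (Y t ^+ 4)%R] < +oo)%E.

Lemma integrable_fourth : P.-integrable setT (fun t => (Y t ^+ 4)%:E).
Proof.
apply/integrableP; split.
  by apply/measurable_EFinP; exact: measurable_funX.
rewrite (eq_integral (fun t => (Y t ^+ 4)%:E)) => [|t _].
  by move: Y4; rewrite unlock.
by rewrite gee0_abs// lee_fin (exprM _ 2 2) sqr_ge0.
Qed.

Lemma expectation_cvg (f_ : nat -> R -> R) (f : R -> R) :
  (forall k, measurable_fun [set: R] (f_ k)) -> measurable_fun [set: R] f ->
  (forall x, f_ ^~ x @ \oo --> f x) ->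
  (forall k x, `|f_ k x| <= 1 + x ^+ 4) ->
  ('E_P[fun t => f_ k (Y t)] @[k --> \oo] --> 'E_P[fun t => f (Y t)])%E.
Proof.
move=> mf_ mf cf df.
have mY : measurable_fun [set: T] Y by [].
have idom : P.-integrable setT (fun t => (1 + Y t ^+ 4)%:E).
  have := integrableD measurableT
    (finite_measure_integrable_cst P 1 (measurableT : measurable [set: T]))
    integrable_fourth.
  by [].
have [] := @dominated_convergence _ T R P setT measurableT
  (fun k t => (f_ k (Y t))%:E) (fun t => (f (Y t))%:E) (fun t => (1 + Y t ^+ 4)%:E).
- by move=> k; apply/measurable_EFinP; exact: measurableT_comp (mf_ k) mY.
- by apply/measurable_EFinP; exact: measurableT_comp mf mY.
- by apply: aeW => t _; apply: cvg_comp (cf (Y t)) _; exact: cvg_id.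
- exact: idom.
- by apply: aeW => t k _ /=; rewrite lee_fin.
by move=> _ _; rewrite unlock.
Qed.

Lemma variance_centered : ('E_P[Y] = 0)%E ->
  ('E_P[fun t => (Y t ^+ 2)%R] = 'V_P[Y])%E.
Proof.
move=> E0; rewrite /variance covariance.unlock E0; congr (expectation _ _).
by apply/funext => t /=; rewrite !fctE /= subr0 expr2.
Qed.

End MomentConvergence.


Lemma fourth_moment_ge1 (d : measure_display) (T : measurableType d)
    (R : realType) (P : probability T R) (Y : {RV P >-> R}) (m4 : R) :
  ('E_P[fun t => (Y t ^+ 2)%R] = 1)%E ->
  ('E_P[fun t => (Y t ^+ 4)%R] = m4%:E)%E -> 1 <= m4.
Proof.
move=> Y2 Y4; have mY : measurable_fun [set: T] Y by [].
have : ('E_P[fun t => (2 * Y t ^+ 2)%R] <= 'E_P[fun t => (1 + Y t ^+ 4)%R])%E.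
  apply: expectation_le.
  - by apply: measurable_funM => //; exact: measurable_funX.
  - by apply: measurable_funD => //; exact: measurable_funX.
  - by move=> t; rewrite mulr_ge0 ?sqr_ge0.
  - by move=> t; rewrite addr_ge0// (exprM _ 2 2) sqr_ge0.
  - apply: aeW => t /=; rewrite -subr_ge0.
    by rewrite (_ : _ - _ = (Y t ^+ 2 - 1) ^+ 2) ?sqr_ge0//; ring.
have -> : ('E_P[fun t => (2 * Y t ^+ 2)%R] = 2%:E)%E.
  rewrite -[RHS]mule1 -Y2 unlock; under eq_integral do rewrite EFinM.
  rewrite ge0_integralZl//.
  - by apply/measurable_EFinP; exact: measurable_funX.
  - by move=> t _; rewrite lee_fin sqr_ge0.
have -> : ('E_P[fun t => (1 + Y t ^+ 4)%R] = (1 + m4)%:E)%E.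
  rewrite EFinD -Y4 unlock; under eq_integral do rewrite EFinD.
  rewrite ge0_integralD//.
  - by congr (_ + _)%E; have := expectation_cst P 1; rewrite unlock.
  - by move=> t _; rewrite lee_fin (exprM _ 2 2) sqr_ge0.
  - by apply/measurable_EFinP; exact: measurable_funX.
by rewrite lee_fin; lra.
Qed.

(** The event V <= z is eventually contained in V_ k <= z + e, for any e > 0, and
    V > z in V_ k > z. The shift by e <= 1/2 changes 1 + |z| by a factor of at most
    2, whence the factor 4, and Phi by at most e. *)
Lemma Phi_bound_of_approx (R : realType) (d : measure_display)
    (T : measurableType d) (P : probability T R) (V : T -> R) (V_ : nat -> T -> R)
    (B : R) (k0 : nat) :
  measurable_fun [set: T] V -> (forall k, measurable_fun [set: T] (V_ k)) ->
  (forall t, V_ ^~ t @ \oo --> V t) -> 0 <= B ->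
  (forall k z, (k0 <= k)%N ->
     `|fine (P [set t | V_ k t <= z]) - Phi z| <= B / (1 + `|z|) ^+ 2) ->
  forall z, `|fine (P [set t | V t <= z]) - Phi z| <= 4 * B / (1 + `|z|) ^+ 2.
Proof.
move=> mV mV_ cV B0 bound z.
have z1 : 0 < (1 + `|z|) ^+ 2 by rewrite exprn_gt0// ltr_wpDr.
have mle (U : T -> R) y : measurable_fun [set: T] U -> measurable [set t | U t <= y].
  move=> mU; rewrite (_ : [set _ | _] = U @^-1` `]-oo, y]).
    by rewrite -[X in measurable X]setTI; exact: mU.
  by apply/seteqP; split=> t /=; rewrite in_itv.
have mgt (U : T -> R) y : measurable_fun [set: T] U -> measurable [set t | y < U t].
  move=> mU; rewrite (_ : [set _ | _] = U @^-1` `]y, +oo[).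
    by rewrite -[X in measurable X]setTI; exact: mU.
  by apply/seteqP; split=> t /=; rewrite in_itv/= andbT.
have Pgt (U : T -> R) y : measurable_fun [set: T] U ->
    fine (P [set t | y < U t]) = 1 - fine (P [set t | U t <= y]).
  move=> mU; rewrite (_ : [set t | y < U t] = ~` [set t | U t <= y]).
    rewrite probability_setC; last exact: mle.
    by rewrite fineB ?fin_num_measure//; exact: mle.
  by apply/seteqP; split=> t /=; rewrite ltNge => /negP.
have upper : fine (P [set t | V t <= z]) <= Phi z + 4 * B / (1 + `|z|) ^+ 2.
  apply/ler_addgt0Pr => e e0.
  pose e' : R := Num.min e (2^-1).
  have e'0 : 0 < e' by rewrite lt_min e0 invr_gt0 ltr0n.
  have e'e : e' <= e by rewrite ge_min lexx.
  have e'2 : e' <= 2^-1 by rewrite ge_min lexx orbT.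
  apply: (@le_trans _ _ (Phi (z + e') + B / (1 + `|z + e'|) ^+ 2)).
    apply: (@probability_liminf_le _ _ _ _ _ (fun k => [set t | V_ k t <= z + e']) _ k0).
    - exact: mle.
    - by move=> k; exact: mle.
    - move=> t /= Vz; have Vlt : V t < z + e' by apply: le_lt_trans Vz _; rewrite ltrDl.
      have [N _ HN] := @cvgr_lt _ _ _ _ _ _ (cV t) _ Vlt.
      by exists N => k Nk; apply: ltW; exact: HN.
    - move=> k k0k; have := bound k (z + e') k0k.
      by rewrite ler_norml => /andP[_]; lra.
  have zz : z <= z + e' by rewrite lerDl ltW.
  have := Phi_lip zz.
  have : B / (1 + `|z + e'|) ^+ 2 <= 4 * B / (1 + `|z|) ^+ 2.
    have le2 : 1 + `|z| <= 2 * (1 + `|z + e'|).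
      have : `|z| <= `|z + e'| + `|e'|.
        by rewrite -[X in `|X| <= _](addrK e') ler_normB.
      by rewrite (ger0_norm (ltW e'0)); have := normr_ge0 (z + e'); lra.
    have z2 : 0 < (1 + `|z + e'|) ^+ 2 by rewrite exprn_gt0// ltr_wpDr.
    rewrite ler_pdivrMr// mulrAC ler_pdivlMr// -mulrA mulrCA ler_wpM2l//.
    rewrite (_ : 4 * _ = (2 * (1 + `|z + e'|)) ^+ 2); last by ring.
    by rewrite lerXn2r ?nnegrE// ?mulr_ge0// ?addr_ge0.
  by lra.
have lower : Phi z - B / (1 + `|z|) ^+ 2 <= fine (P [set t | V t <= z]).
  suff : fine (P [set t | z < V t]) <= 1 - (Phi z - B / (1 + `|z|) ^+ 2).
    by rewrite Pgt//; lra.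
  apply: (@probability_liminf_le _ _ _ _ _ (fun k => [set t | z < V_ k t]) _ k0).
  - exact: mgt.
  - by move=> k; exact: mgt.
  - move=> t /= zV; have [N _ HN] := @cvgr_gt _ _ _ _ _ _ (cV t) _ zV.
    by exists N => k Nk; exact: HN.
  - move=> k k0k; rewrite Pgt//; have := bound k z k0k.
    by rewrite ler_norml => /andP[]; lra.
have B' : B / (1 + `|z|) ^+ 2 <= 4 * B / (1 + `|z|) ^+ 2.
  by rewrite ler_wpM2r ?invr_ge0 ?(ltW z1)//; lra.
rewrite ler_norml; apply/andP; split; lra.
Qed.

Theorem theorem4p1 (R : realType) :
  exists C : R -> R,
  forall (n : nat) (d : measure_display) (T : measurableType d)
    (P : probability T R) (X : 'I_n.+1 -> {RV P >-> R}) (A : 'M[R]_n.+1),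
    iid X ->
    (forall i, 'E_P[X i] = 0)%E ->
    (forall i, 'V_P[X i] = 1)%E ->
    (forall i, 'E_P[fun t => (X i t ^+ 4)%R] < +oo)%E ->
    A^T = A ->
    (forall i, A i i = 0) ->
    0 < sigma2 A ->
    let m4 := fine ('E_P[fun t => (X ord0 t ^+ 4)%R])%E in
    forall z : R,
      `| fine (P [set t | W A X t <= z]) - Phi z | <=
      C m4 * m4 / ((1 + `|z|) ^+ 2 * sigma2 A) *
      (Num.sqrt (\sum_i (\sum_j A i j ^+ 2) ^+ 2) +
       Num.sqrt (\sum_i \sum_j (\sum_k A i k * A j k) ^+ 2)).
Proof.
(* The factor 4 is due to the passage to the limit, 10^6 to the finite case, and
   (64 m)^2 to its dependence on the fourth moment after standardisation; one
   factor m is already in the statement. *)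
exists (fun m => 4 * 10 ^+ 6 * 64 ^+ 2 * m).
move=> n d T P X A X_iid EX VX X4 A_sym A_diag sA m4 z.
pose Y := X ord0.
have [g [mg fg g_le cg]] := id_approximation R.
pose a1 k := fine ('E_P[fun t => g k (Y t)])%E.
pose a2 k := fine ('E_P[fun t => (g k (Y t) ^+ 2)%R])%E.
have fin k (f : R -> R) : ('E_P[fun t => f (g k (Y t))] \is a fin_num)%E.
  by have [F [p [v [_ _ ->]]]] := finite_valued_law X (mg k) (fg k).
have le4 (x : R) : `|x| <= 1 + x ^+ 4 /\ x ^+ 2 <= 1 + x ^+ 4.
  have x40 : 0 <= x ^+ 4 by rewrite (exprM x 2 2) sqr_ge0.
  have x2 : x ^+ 2 <= 1 + x ^+ 4.
    rewrite -subr_ge0 (_ : _ - _ = (x ^+ 2 - 2^-1) ^+ 2 + 3 / 4); last by field.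
    by rewrite addr_ge0 ?sqr_ge0.
  split=> //; have ax : 2 * `|x| <= 1 + x ^+ 2.
    rewrite -(real_normK (num_real x)) -subr_ge0.
    by rewrite (_ : _ - _ = (`|x| - 1) ^+ 2) ?sqr_ge0//; ring.
  by lra.
have c1 : a1 @ \oo --> (0 : R).
  have := @expectation_cvg _ _ _ P Y (X4 ord0) g id mg (@measurable_id _ _ _) cg.
  rewrite (_ : (fun t => id (Y t)) = Y)// EX => /(_ _)/fine_cvgP[] // k x.
  exact: le_trans (g_le k x) (le4 x).1.
have c2 : a2 @ \oo --> (1 : R).
  have msq (h : R -> R) : measurable_fun [set: R] h ->
      measurable_fun [set: R] (fun x => h x ^+ 2).
    by move=> mh; exact: measurable_funX.
  have csq (x : R) : (fun k => g k x ^+ 2) @ \oo --> x ^+ 2.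
    by rewrite expr2; under eq_fun do rewrite expr2; exact: cvgM.
  have dsq k x : `|g k x ^+ 2| <= 1 + x ^+ 4.
    rewrite normrX; apply: le_trans _ (le4 x).2.
    by rewrite -(real_normK (num_real x)) lerXn2r ?nnegrE.
  have := @expectation_cvg _ _ _ P Y (X4 ord0) (fun k x => g k x ^+ 2)
    (fun x => x ^+ 2) (fun k => msq _ (mg k)) (msq id (@measurable_id _ _ _)) csq dsq.
  by rewrite (variance_centered (EX ord0)) VX => /fine_cvgP[].
pose var k := a2 k - a1 k ^+ 2.
have cvar : var @ \oo --> (1 : R).
  rewrite -[X in _ --> X](subr0 (1 : R)); apply: cvgB => //.
  rewrite -[X in _ --> X](mulr0 (0 : R)); under eq_fun do rewrite expr2.
  exact: cvgM.
have m4E : ('E_P[fun t => (X ord0 t ^+ 4)%R] = m4%:E)%E.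
  rewrite fineK// ge0_fin_numE ?X4// expectation_ge0// => t.
  by rewrite (exprM _ 2 2) sqr_ge0.
have m41 : 1 <= m4.
  have VY : ('E_P[fun t => (Y t ^+ 2)%R] = 1)%E.
    by rewrite (variance_centered (EX ord0)) VX.
  exact: fourth_moment_ge1 VY m4E.
have g4 k : ('E_P[fun t => (g k (X ord0 t) ^+ 4)%R] <= m4%:E)%E.
  rewrite -m4E; apply: expectation_le.
  - exact/measurable_funX/(measurableT_comp (mg k)).
  - exact: measurable_funX.
  - by move=> t; rewrite (exprM _ 2 2) sqr_ge0.
  - by move=> t; rewrite (exprM _ 2 2) sqr_ge0.
  - apply: aeW => t /=; rewrite !(exprM _ 2 2) lerXn2r ?nnegrE ?sqr_ge0//.
    rewrite -(real_normK (num_real (g k _))) -(real_normK (num_real (X ord0 t))).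
    by rewrite lerXn2r ?nnegrE.
have [k0 Hk0] : exists k0, forall k, (k0 <= k)%N -> `|a1 k| <= 1 /\ 2^-1 <= var k.
  have half1 : 2^-1 < 1 :> R by lra.
  have [N1 _ H1] := @cvgr_lt _ _ _ _ _ _ c1 _ (ltr01 : 0 < 1).
  have [N2 _ H2] := @cvgr_gt _ _ _ _ _ _ c1 _ (ltrN10 R : -1 < 0).
  have [N3 _ H3] := @cvgr_gt _ _ _ _ _ _ cvar _ half1.
  exists (maxn N1 (maxn N2 N3)) => k; rewrite !geq_max => /andP[k1 /andP[k2 k3]].
  split; last by apply: ltW; exact: H3.
  by rewrite ler_norml; apply/andP; split; apply: ltW; [exact: H2|exact: H1].
pose Z k i t := (g k (X i t) - a1 k) / Num.sqrt (var k).
have mX i : measurable_fun [set: T] (X i) by [].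
have mZ k i : measurable_fun [set: T] (Z k i).
  apply: measurable_funM => //; apply: measurable_funB => //.
  exact: measurableT_comp (mg k) (mX i).
have cZ i t : Z k i t @[k --> \oo] --> X i t.
  rewrite (_ : X i t = (X i t - 0) / Num.sqrt 1); last by rewrite sqrtr1 subr0 divr1.
  apply: cvgM; first by apply: cvgB => //; exact: cg.
  apply: cvgV; first by rewrite sqrtr1 oner_eq0.
  exact: (cvg_comp _ _ cvar (@sqrt_continuous R 1)).
pose B := 10 ^+ 6 * (64 * m4) ^+ 2 * fluctuation A.
have B0 : 0 <= B.
  apply: mulr_ge0; last exact: ltW (fluctuation_gt0 sA).
  by apply: mulr_ge0; [rewrite exprn_ge0|exact: sqr_ge0].
have -> : (4 * 10 ^+ 6 * 64 ^+ 2 * m4) * m4 / ((1 + `|z|) ^+ 2 * sigma2 A) *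
      (Num.sqrt (\sum_i (\sum_j A i j ^+ 2) ^+ 2) +
       Num.sqrt (\sum_i \sum_j (\sum_k A i k * A j k) ^+ 2)) =
    4 * B / (1 + `|z|) ^+ 2.
  rewrite /B /fluctuation; field.
  by rewrite !gt_eqF// ltr_wpDr.
apply: (@Phi_bound_of_approx _ _ _ P (W A X) (fun k => W A (Z k)) B k0) => //.
- exact: measurable_W.
- by move=> k; exact: measurable_W.
- by move=> t; apply: W_cvg => i; exact: cZ.
move=> k y k0k; have [mu1 var2] := Hk0 _ k0k.
apply: (standardised_bound X_iid A_sym A_diag sA (mg k) (fg k) _ _ _ (g4 k) m41 mu1 var2).
- by rewrite -(fineK (fin k id)).
- by rewrite /var subrK -(fineK (fin k (fun y => y ^+ 2))).
Qed.
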